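(* Let $2\le m\le n-1$ and let $h_m=(m,n,\ldots,n)$, i.e. $h_m(1)=m$ and $h_m(j)=n$ for $2\le j\le n$. Then the singular locus of $\mathrm{Hess}(N,h_m)\cap\Omega_e^\circ$ is $$\mathrm{Sing}(\mathrm{Hess}(N,h_m)\cap\Omega_e^\circ)=X_{w_m}\cap\Omega_e^\circ .$$
   Context: Write $[n]=\{1,\ldots,n\}$. $Fl(\mathbb{C}^n)$ is the variety of full flags $V_\bullet=(V_1\subset\cdots\subset V_n=\mathbb{C}^n)$, $\dim V_i=i$, identified with $\mathrm{GL}_n(\mathbb{C})/B$ ($B$ = upper triangular invertible matrices) by letting the first $j$ columns of $g$ span $V_j$. Let $N$ be the $n\times n$ nilpotent matrix consisting of a single Jordan block ($N_{i,i+1}=1$, all other entries $0$). For a nondecreasing $h:[n]\to[n]$ with $h(j)\ge j$ for all $j$ (a Hessenberg function), $$\mathrm{Hess}(N,h)=\{V_\bullet\in Fl(\mathbb{C}^n)\mid NV_i\subset V_{h(i)}\text{ for all }i\in[n]\},$$ a (reduced) closed subvariety. $\Omega_e^\circ$ is the opposite Schubert cell of the identity, i.e. the orbit of $eB$ under the group of lower triangular invertible matrices; it is an open affine subset of $Fl(\mathbb{C}^n)$, identified with the set of lower triangular unipotent $n\times n$ matrices. For a permutation $w$ of $[n]$, the Schubert variety is $$X_w=\{V_\bullet\in Fl(\mathbb{C}^n)\mid \dim(V_p\cap F_q)\ge|\{i\in[p]\mid w(i)\le q\}|\text{ for all }p,q\in[n]\},$$ where $F_q=\mathrm{span}_{\mathbb{C}}\{e_1,\ldots,e_q\}$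 and $e_1,\ldots,e_n$ is the standard basis of $\mathbb{C}^n$. The permutation $w_m$ of $[n]$ is defined by $w_m(1)=1$; $w_m(i)=n+1-i$ for $2\le i\le m$; $w_m(m+1)=n$; and $w_m(i)=n+2-i$ for $m+2\le i\le n$. *)

(* Defs.v *)
From HB Require Import structures.
From mathcomp Require Import all_boot all_order all_algebra all_fingroup.
From mathcomp Require Import mpoly.
From mathcomp Require Import complex.
From mathcomp Require Import reals.
From mathcomp Require Import zify.

Set Implicit Arguments.
Unset Strict Implicit.
Unset Printing Implicit Defensive.

Import GRing.Theory.
Local Open Scope ring_scope.

Section AffineVarieties.
Variables (K : fieldType) (d : nat).
Implicit Types (Y Z : 'rV[K]_d -> Prop) (x p v : 'rV[K]_d) (f : {mpoly K[d]}).

Definition peval f x : K := f.@[fun i => x 0 i].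

Definition included Y Z : Prop := forall x, Y x -> Z x.

Definition vanishing_ideal Z f : Prop := forall x, Z x -> peval f x = 0.

Definition zariski_closed Z : Prop :=
  exists S : {mpoly K[d]} -> Prop,
    forall x, Z x <-> (forall f, S f -> peval f x = 0).

Definition irreducible_closed Y : Prop :=
  [/\ zariski_closed Y,
      exists x, Y x
    & forall A B, zariski_closed A -> zariski_closed B ->
        included Y (fun x => A x \/ B x) -> included Y A \/ included Y B].

Definition irreducible_component Z Y : Prop :=
  [/\ irreducible_closed Y,
      included Y Z
    & forall Y', irreducible_closed Y' -> included Y Y' -> included Y' Z ->
        included Y' Y].

(* The residue classes of s_1, ..., s_r in K[Y] = K[x_1, ..., x_d] / I(Y)
   satisfy no nontrivial polynomial relation over K. *)
Definition alg_independent_on Y (r : nat) (s : r.-tuple {mpoly K[d]}) : Prop :=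
  forall g : {mpoly K[r]}, vanishing_ideal Y (g \mPo s) -> g = 0.

(* For Y irreducible, r is the transcendence degree over K of the function
   field K(Y).  Since K(Y) = Frac K[Y], a transcendence basis can be chosen
   in K[Y], so only regular functions need to be considered. *)
Definition has_dim Y (r : nat) : Prop :=
  (exists s : r.-tuple {mpoly K[d]}, alg_independent_on Y s) /\
  (forall r' (s : r'.-tuple {mpoly K[d]}), alg_independent_on Y s ->
     (r' <= r)%N).

(* dim_p Z = r: the maximal dimension of a component of Z through p. *)
Definition has_local_dim Z p (r : nat) : Prop :=
  (exists Y, [/\ irreducible_component Z Y, Y p & has_dim Y r]) /\
  (forall Y r', irreducible_component Z Y -> Y p -> has_dim Y r' ->
     (r' <= r)%N).

(* T is the Zariski tangent space at p of Z with its reduced structure: the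
   differentials range over the full vanishing ideal of Z. *)
Definition is_tangent_space Z p (T : {vspace 'rV[K]_d}) : Prop :=
  forall v, v \in T <->
    (forall f, vanishing_ideal Z f ->
       \sum_(i < d) peval (f^`M(i)) p * v 0 i = 0).

Definition nonsingular_point Z p : Prop :=
  Z p /\ exists r T,
    [/\ has_local_dim Z p r, is_tangent_space Z p T & \dim T = r].

Definition singular_point Z p : Prop := Z p /\ ~ nonsingular_point Z p.

End AffineVarieties.

Section Flags.
Variables (K : fieldType) (n : nat).

(* A full flag V_1 < ... < V_n = K^n is indexed by nat with its usual
   indices 1, ..., n, and prolonged by V_0 = 0 and V_i = K^n for i > n. *)
Record flag := Flag {
  flag_space :> nat -> {vspace 'cV[K]_n};
  flag_dim : forall i, \dim (flag_space i) = minn i n;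
  flag_mono : forall i j, (i <= j)%N -> (flag_space i <= flag_space j)%VS
}.

(* Matrix and permutation indices i : 'I_n are 0-based: they stand for i.+1
   in {1, ..., n}, so that "i < j" below selects the first j indices. *)
Definition col_span (g : 'M[K]_n) (j : nat) : {vspace 'cV[K]_n} :=
  <<[seq col i g | i : 'I_n <- enum 'I_n & (i < j)%N]>>%VS.

Definition std_space (q : nat) : {vspace 'cV[K]_n} :=
  <<[seq delta_mx i ord0 | i : 'I_n <- enum 'I_n & (i < q)%N]>>%VS.

(* V is the point g B of GL_n(K) / B. *)
Definition represents (g : 'M[K]_n) (V : flag) : Prop :=
  forall j, V j = col_span g j.

Definition hessenberg_function (h : nat -> nat) : Prop :=
  (forall j, (1 <= j <= n)%N -> (j <= h j <= n)%N) /\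
  (forall i j, (1 <= i)%N -> (i <= j <= n)%N -> (h i <= h j)%N).

Definition Hess (A : 'M[K]_n) (h : nat -> nat) (V : flag) : Prop :=
  forall i, (1 <= i <= n)%N -> forall v, v \in V i -> A *m v \in V (h i).

Definition nilpotent_block : 'M[K]_n :=
  \matrix_(i, j) (j == i.+1 :> nat)%:R.

Definition lower_triangular (b : 'M[K]_n) : Prop :=
  forall i j : 'I_n, (i < j)%N -> b i j = 0.

Definition lower_unipotent (u : 'M[K]_n) : Prop :=
  lower_triangular u /\ forall i, u i i = 1.

Definition opposite_cell (V : flag) : Prop :=
  exists b : 'M[K]_n, [/\ b \in unitmx, lower_triangular b
    & forall j, V j = (linfun (mulmx b) @: std_space j)%VS].

Definition schubert_variety (w : {perm 'I_n}) (V : flag) : Prop :=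
  forall p q, (1 <= p <= n)%N -> (1 <= q <= n)%N ->
    (#|[set i : 'I_n | (i < p)%N && (w i < q)%N]|
       <= \dim (V p :&: std_space q))%N.

(* The part of Z in the opposite cell, in the affine coordinates given by the
   entries of the unique lower unipotent matrix representing a flag; lower
   unipotent matrices form a closed subset of the space of all n x n matrices. *)
Definition cell_coordinates (Z : flag -> Prop) (x : 'rV[K]_(n * n)) : Prop :=
  exists u V, [/\ lower_unipotent u, represents u V, Z V & x = mxvec u].

(* The singular locus of Z, for Z contained and closed in the opposite cell. *)
Definition cell_singular_locus (Z : flag -> Prop) (V : flag) : Prop :=
  exists u, [/\ lower_unipotent u, represents u V
    & singular_point (cell_coordinates Z) (mxvec u)].

End Flags.

Definition h_m (n m j : nat) : nat := if j == 1%N then m else n.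

Lemma h_m_hessenberg n m :
  (2 <= m <= n - 1)%N -> hessenberg_function n (h_m n m).
Proof.
move=> hm; split=> [j|i j]; rewrite /h_m; first by case: (j =P 1%N) => ?; lia.
by case: (i =P 1%N) => ?; case: (j =P 1%N) => ?; lia.
Qed.

Definition w_m_val (n m i : nat) : nat :=
  if i == 1%N then 1%N
  else if (i <= m)%N then (n + 1 - i)%N
  else if i == m.+1 then n
  else (n + 2 - i)%N.

Lemma w_m_val_bounds n m i : (2 <= m <= n - 1)%N -> (1 <= i <= n)%N ->
  (1 <= w_m_val n m i <= n)%N.
Proof.
move=> hm hi; rewrite /w_m_val.
by case: (i =P 1%N) => ?; case: (leqP i m) => ?; case: (i =P m.+1) => ?; lia.
Qed.

Lemma w_m_val_inj n m i j : (2 <= m <= n - 1)%N ->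
  (1 <= i <= n)%N -> (1 <= j <= n)%N ->
  w_m_val n m i = w_m_val n m j -> i = j.
Proof.
move=> hm hi hj; rewrite /w_m_val.
by case: (i =P 1%N) => ?; case: (j =P 1%N) => ?;
   case: (leqP i m) => ?; case: (leqP j m) => ?;
   case: (i =P m.+1) => ?; case: (j =P m.+1) => ?; lia.
Qed.

Section PermutationWm.
Variables (n m : nat) (hm : (2 <= m <= n - 1)%N).

Lemma w_m_ord_subproof (i : 'I_n) : ((w_m_val n m i.+1).-1 < n)%N.
Proof.
have := w_m_val_bounds (i := i.+1) hm (ltn_ord i).
by lia.
Qed.

Definition w_m_ord (i : 'I_n) : 'I_n := Ordinal (w_m_ord_subproof i).

Lemma w_m_ord_inj : injective w_m_ord.
Proof.
move=> i j /(congr1 val) /= eq_ij; apply: val_inj.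
have bi := w_m_val_bounds (i := i.+1) hm (ltn_ord i).
have bj := w_m_val_bounds (i := j.+1) hm (ltn_ord j).
suff [] : i.+1 = j.+1 by [].
by apply: (w_m_val_inj hm); rewrite ?ltn_ord //; lia.
Qed.

Definition w_m : {perm 'I_n} := perm w_m_ord_inj.

Lemma w_mE (i : 'I_n) : (w_m i).+1 = w_m_val n m i.+1.
Proof.
rewrite permE /=.
have := w_m_val_bounds (i := i.+1) hm (ltn_ord i).
by lia.
Qed.

End PermutationWm.

(* Main.v *)
From HB Require Import structures.
Require Import Defs.
From mathcomp Require Import all_boot all_order all_algebra all_fingroup.
From mathcomp Require Import boolp.
From mathcomp Require Import complex reals.
From mathcomp Require Import mpoly zify ring.
Set Implicit Arguments.
Unset Strict Implicit.
Unset Printing Implicit Defensive.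
Import GRing.Theory.
Local Open Scope ring_scope.

(** A flag in the opposite cell is a lower unipotent matrix u with columns
    c_1, ..., c_n.  Write N c_1 = a_1 c_1 + ... + a_n c_n, that is
    a = u^-1 N c_1 ([shift_coords]).  The flag lies in Hess(N, h_m) exactly when
    a_j = 0 for j > m; let Z be the closed set cut out by these n - m equations.

    On the open set a_k <> 0, with 2 <= k <= m, the equations can be solved for
    the bottom n - m entries of c_k: adding a_k^-1 (a_(m+1) c_(m+1) + ... + a_n c_n)
    to c_k retracts it onto the part of Z where a_k <> 0 ([hess_retraction]).
    If a_k = 0 for all k >= 2, then c_1 is an eigenvector of N, so c_1 = e_1.
    Through each such point passes an explicit curve in Z along which a_2 is not
    identically 0 ([axis_curve]), so the part of Z with a_2 <> 0 is dense
    ([hess_cell_dense]).  That part is the image of a rational section over an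
    affine space, whence Z is irreducible of codimension n - m
    ([hess_cell_irreducible], [hess_cell_has_dim]).

    Lines, the retractions and the explicit curves also give enough velocity
    vectors to show that at every point the tangent space of the reduced set Z is
    the kernel of the differential of the equations ([tangent_hess]).  So a point
    is nonsingular exactly when this differential,
      v |-> the entries of index > m of u^-1 (N v_1 - v a),
    maps the strictly lower triangular matrices onto K^(n-m).  If some a_k <> 0
    with k >= 2, varying column k alone suffices.  Otherwise c_1 = e_1 and a = 0,
    the vectors N v_1 fill F_(n-1), and the map is onto unless V_m is contained in
    F_(n-1).  Hence the singular points are those with V_1 = F_1 and V_m contained
    in F_(n-1) ([singular_hess_cell]), and a count of the entries of w_m shows that
    these two conditions define its Schubert variety ([schubert_w_mP]).

    Columns and entries are numbered from 1 in the subscripts above and below, while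
    matrix indices start at 0, so that j > m becomes (m <= j); a phrase such as
    index at least m refers to matrix indices.

    Everything holds over an arbitrary infinite field.  Dimensions are bounded
    above by counting monomials ([rational_functions_dependent]), and derivatives
    are taken formally along curves with rational coordinates ([has_velocity]). *)

(** * Polynomials over an infinite field *)

Definition infinite_field (K : fieldType) : Prop :=
  forall N, exists s : seq K, uniq s /\ size s = N.

Section Nonvanishing.
Variables (K : fieldType) (infK : infinite_field K).

Lemma poly_nonroot (p : {poly K}) : p != 0 -> exists t, p.[t] != 0.
Proof.
move=> p0; have [s [us ss]] := infK (size p).
case: (boolP (all (root p) s)) => [ar|/allPn[t _ nr]]; last by exists t.
by have := max_poly_roots p0 ar us; rewrite ss ltnn.
Qed.

(** Induction on the number of variables: a nonzero coefficient of p with respect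
    to its last variable is nonzero at some point, which leaves a nonzero
    polynomial in one variable. *)
Lemma mpoly_nonroot e (p : {mpoly K[e]}) : p != 0 -> exists v, p.@[v] != 0.
Proof.
elim: e p => [|e IH] p p0.
  have [m pm] : exists m, p@_m != 0.
    have : mlead p \in msupp p by rewrite mlead_supp.
    by rewrite mcoeff_msupp => h; exists (mlead p).
  exists (fun _ => 0); rewrite mevalE.
  have m0 (m1 m2 : 'X_{1..0}) : m1 = m2 by apply/mnmP => -[].
  rewrite (big_rem m) ?mcoeff_msupp //= big_ord0 mulr1 big1_seq ?addr0 //.
  move=> m' /=; rewrite mem_rem_uniq ?msupp_uniq // inE => /andP[/eqP h _].
  by case: h; apply: m0.
have [k qk] : exists k, (muni p)`_k != 0.
  have : mlead p \in msupp p by rewrite mlead_supp.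
  set m := mlead p => pm; exists (m ord_max).
  apply: contraTneq (pm) => h.
  have /(congr1 (fun q => q@_[multinom m (widen_ord (leqnSn e) i) | i < e])) := h.
  rewrite mcoeff0 muniE coef_sum raddf_sum /= mcoeff_msupp negbK => <-.
  apply/eqP; rewrite (big_rem m) //= big1_seq.
    rewrite coefZ coefXn eqxx mulr1 mcoeffZ mcoeffX eqxx mulr1 addr0 //.
  move=> m' /=; rewrite mem_rem_uniq ?msupp_uniq // inE => /andP[/eqP ne _].
  rewrite coefZ coefXn; case: eqP => [e1|_]; last by rewrite mulr0 mcoeff0.
  rewrite mulr1 mcoeffZ mcoeffX; case: eqP => [e2|_]; last by rewrite mulr0.
  case: ne; apply/mnmP => i; case: (unliftP ord_max i) => [j|] ->; last by rewrite e1.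
  have := congr1 (fun q : 'X_{1..e} => q j) e2; rewrite !mnmE.
  by rewrite (_ : widen_ord _ j = lift ord_max j) //; apply: val_inj; rewrite /= /bump leqNgt ltn_ord.
have [v qv] := IH _ qk.
have q0 : map_poly (meval v) (muni p) != 0.
  by apply: contraNneq qv => /(congr1 (fun q : {poly K} => q`_k)); rewrite coef_map coef0 => ->.
have [t qt] := poly_nonroot q0.
exists (fun i => oapp v t (unlift ord_max i)).
apply: contraNneq qt => h; rewrite -h mevalE muniE !rmorph_sum /= horner_sum.
apply/eqP; apply: eq_bigr => m _.
rewrite -mul_polyC rmorphM /= map_polyC map_polyXn /= hornerM hornerC hornerXn.
rewrite mevalZ mevalX big_ord_recr /= unlift_none -mulrA; congr (_ * (_ * _)).
apply: eq_bigr => i _.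
rewrite (_ : widen_ord _ i = lift ord_max i) ?liftK /=; last first.
  by apply: val_inj; rewrite /= /bump leqNgt ltn_ord.
by rewrite mnmE; congr (_ ^+ m _); apply: val_inj; rewrite /= /bump leqNgt ltn_ord.
Qed.

End Nonvanishing.

(** * Upper bound for transcendence degrees *)

Section Dependence.
Variables (K : fieldType) (e : nat).
Implicit Types p q : {mpoly K[e]}.

Lemma msizeM_bound a b p q : (msize p <= a.+1)%N -> (msize q <= b.+1)%N ->
  (msize (p * q) <= (a + b).+1)%N.
Proof.
move=> pa qb; have [->|p0] := eqVneq p 0; first by rewrite mul0r msize0.
have [->|q0] := eqVneq q 0; first by rewrite mulr0 msize0.
by rewrite msizeM //; move: (msize p) (msize q) pa qb => x y; lia.
Qed.

Lemma msizeX_bound a k p : (msize p <= a.+1)%N -> (msize (p ^+ k) <= (a * k).+1)%N.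
Proof.
move=> pa; elim: k => [|k IH]; first by rewrite expr0 msize1.
by rewrite exprS mulnS; apply: msizeM_bound.
Qed.

Lemma msize_prod_bound a r (F : 'I_r -> {mpoly K[e]}) :
  (forall i, (msize (F i) <= a.+1)%N) -> (msize (\prod_i F i) <= (a * r).+1)%N.
Proof.
elim: r F => [|r IH] F Fa; first by rewrite big_ord0 msize1.
by rewrite big_ord_recl mulnS; apply: msizeM_bound => //; apply: IH.
Qed.

Lemma card_bounded_monomials b : (0 < b)%N -> (#|{: 'X_{1..e < b}}| <= b ^ e)%N.
Proof.
move=> b0; pose f (m : 'X_{1..e < b}) := [ffun i : 'I_e => insubd (Ordinal b0) (m i)].
suff /leq_card : injective f by rewrite card_ffun !card_ord.
move=> m1 m2 /ffunP eqf; apply/val_inj/mnmP => i.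
have lt (m : 'X_{1..e < b}) : (m i < b)%N.
  apply: leq_ltn_trans (bmdeg m); rewrite mdegE (bigD1 i) //= leq_addr //.
by have /(congr1 val) := eqf i; rewrite !ffunE !val_insubd !lt.
Qed.

(** Counting: the monomials in r variables with all exponents below M number M ^ r;
    their values at P_i / D, cleared of denominators, have degree linear in M in
    only e variables, hence lie in a space of dimension O(M ^ e). *)
Lemma rational_functions_dependent r (P : 'I_r -> {mpoly K[e]}) (D : {mpoly K[e]}) :
  (e < r)%N ->
  exists2 g : {mpoly K[r]}, g != 0
    & forall v, D.@[v] != 0 -> g.@[fun i => (P i).@[v] / D.@[v]] = 0.
Proof.
move=> er.
have [s sP sD] : exists2 s, (forall i, msize (P i) <= s.+1)%N & (msize D <= s.+1)%N.
  exists (\sum_i msize (P i) + msize D)%N => [i|]; last by apply/leqW/leq_addl.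
  by apply/leqW; rewrite (bigD1 i) //= -addnA leq_addr.
(* Any M above C ^ e gives (C * M) ^ e < M ^ e.+1 <= M ^ r. *)
pose C := (s * r).+1; have [M1 M1E] : exists M1, M1 = (C ^ e)%N by exists (C ^ e)%N.
pose M := M1.+1; pose b := (C * M)%N.
pose Q (al : {ffun 'I_r -> 'I_M}) := \prod_i (P i ^+ al i * D ^+ (M1 - al i)).
have Qb al : (msize (Q al) <= b)%N.
  have : (msize (Q al) <= (s * M1 * r).+1)%N.
    apply: msize_prod_bound => i.
    have -> : (s * M1 = s * al i + s * (M1 - al i))%N.
      by rewrite -mulnDr subnKC // -ltnS.
    by apply: msizeM_bound; apply: msizeX_bound.
  by move/leq_trans; apply; rewrite /b /C /M /=; nia.
pose A : 'M[K]_(#|{: {ffun 'I_r -> 'I_M}}|, #|{: 'X_{1..e < b}}|) :=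
  \matrix_(i, j) (Q (enum_val i))@_(enum_val j : 'X_{1..e < b}).
have : ~~ row_free A.
  apply/negP => /eqP rA.
  have := rank_leq_col A; rewrite rA leqNgt => /negP; apply.
  apply: leq_ltn_trans (card_bounded_monomials _) _; first by rewrite muln_gt0.
  rewrite card_ffun !card_ord expnMn.
  apply: leq_trans (_ : M ^ e.+1 <= _)%N; last by rewrite leq_pexp2l.
  by rewrite expnS -M1E ltn_pmul2r ?expn_gt0.
rewrite -kermx_eq0 => /rowV0Pn[c /sub_kermxP cA c0].
pose mon (al : {ffun 'I_r -> 'I_M}) := [multinom (al i : nat) | i < r].
have mon_inj : injective mon.
  move=> a1 a2 eqm; apply/ffunP => i; apply: val_inj.
  by have := congr1 (fun q : 'X_{1..r} => q i) eqm; rewrite !mnmE.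
pose g := \sum_i c 0 i *: 'X_[mon (enum_val i)] : {mpoly K[r]}.
exists g.
  apply: contraNneq c0 => g0; apply/eqP/rowP => i; rewrite mxE.
  have := congr1 (fun q : {mpoly K[r]} => q@_(mon (enum_val i))) g0.
  rewrite /g mcoeff0 raddf_sum /= (bigD1 i) //= mcoeffZ mcoeffX eqxx mulr1.
  rewrite big1 ?addr0 // => j ji; rewrite mcoeffZ mcoeffX.
  by rewrite (inj_eq mon_inj) (inj_eq enum_val_inj) (negbTE ji) mulr0.
move=> v Dv; apply: (mulIf (expf_neq0 (M1 * r) Dv)); rewrite mul0r.
rewrite /g raddf_sum /= mulr_suml.
have mono al : 'X_[mon al].@[fun i => (P i).@[v] / D.@[v]] * D.@[v] ^+ (M1 * r)
    = (Q al).@[v].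
  rewrite mevalX exprM -[in X in _ ^+ X](card_ord r) -prodr_const -big_split /=.
  rewrite rmorph_prod; apply: eq_bigr => i _; rewrite mnmE rmorphM !rmorphXn /=.
  have -> : M1 = (al i + (M1 - al i))%N by rewrite subnKC // -ltnS.
  by rewrite addKn exprD mulrA expr_div_n divfK // expf_neq0.
under eq_bigr => i _ do rewrite mevalZ -mulrA mono (mpolywE (Qb _)) raddf_sum /= mulr_sumr.
rewrite exchange_big /= big1 // => m _.
have := congr1 (fun B : 'rV__ => B 0 (enum_rank m)) cA; rewrite !mxE.

move=> h; rewrite -[RHS](mul0r (meval v (mpolyX K m))) -[X in _ = X * _]h mulr_suml.
by apply: eq_bigr => i _; rewrite mevalZ mulrA [A _ _]mxE enum_rankK.
Qed.
End Dependence.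

(** * Sets with a dense rational parametrisation *)

Section RationalParametrisation.
Variables (K : fieldType) (infK : infinite_field K) (d e : nat).
Variables (Z : 'rV[K]_d -> Prop) (num : 'I_d -> {mpoly K[e]}) (delta : {mpoly K[e]}).
Variable idx : 'I_e -> 'I_d.

(** A common denominator [delta] keeps all coordinates in one shape; points where it
    vanishes are never used, although the formula is total. *)
Definition param_point (v : 'I_e -> K) : 'rV[K]_d :=
  \row_i ((num i).@[v] / delta.@[v]).

(** Homogenise: a polynomial of degree at most N becomes a polynomial once
    multiplied by delta ^ N. *)
Lemma peval_param N (g : {mpoly K[d]}) : (msize g <= N)%N ->
  exists G : {mpoly K[e]}, forall v, delta.@[v] != 0 ->
    peval g (param_point v) = G.@[v] / (delta ^+ N).@[v].
Proof.
move=> gN.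
exists (\sum_(m <- msupp g) g@_m *: (\prod_i num i ^+ m i * delta ^+ (N - mdeg m))).
move=> v dv; have dN : (delta ^+ N).@[v] != 0 by rewrite rmorphXn expf_neq0.
apply: (mulIf dN); rewrite divfK // /peval mevalE mulr_suml raddf_sum /=.
apply: eq_big_seq => m gm; rewrite mevalZ -mulrA rmorphM; congr (_ * _).
have mN : (mdeg m <= N)%N by apply: leq_trans gN; apply/ltnW/msize_mdeg_lt.
rewrite !rmorphXn /= -[in LHS](subnKC mN) exprD mulrA; congr (_ * _).
rewrite mdegE -prodrXr -big_split rmorph_prod /=; apply: eq_bigr => i _.
by rewrite mxE rmorphXn /= expr_div_n divfK // expf_neq0.
Qed.

Hypothesis delta_neq0 : delta != 0.
Hypothesis param_in : forall v, delta.@[v] != 0 -> Z (param_point v).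
Hypothesis param_coord :
  forall v, delta.@[v] != 0 -> forall k, param_point v 0 (idx k) = v k.
Hypothesis param_dense : forall g,
  (forall v, delta.@[v] != 0 -> peval g (param_point v) = 0) -> vanishing_ideal Z g.

(** By density the vanishing ideal is the kernel of a map into rational functions in
    e variables, which form a domain. *)
Lemma param_ideal_prime f g :
  vanishing_ideal Z (f * g) -> vanishing_ideal Z f \/ vanishing_ideal Z g.
Proof.
move=> fg.
have [F FE] := peval_param (leqnn (msize f)); have [G GE] := peval_param (leqnn (msize g)).
have FG0 : F * G * delta = 0.
  apply/eqP/negPn/negP => /(mpoly_nonroot infK)[v].
  rewrite rmorphM mulf_eq0 negb_or => /andP[FGv dv]; case/negP: FGv.
  have := fg _ (param_in dv); rewrite /peval rmorphM /= -!/(peval _ _) FE // GE //.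
  move/eqP; rewrite !mulf_eq0 !invr_eq0 !rmorphXn !(negbTE (expf_neq0 _ dv)) !orbF.
  by rewrite -mulf_eq0 -rmorphM.
move/eqP: FG0; rewrite !mulf_eq0 (negbTE delta_neq0) orbF => /orP[]/eqP E; [left|right].
  by apply: param_dense => v dv; rewrite FE // E meval0 mul0r.
by apply: param_dense => v dv; rewrite GE // E meval0 mul0r.
Qed.

Lemma param_irreducible : zariski_closed Z -> irreducible_closed Z.
Proof.
move=> Zc; split => //.
  have [v dv] := mpoly_nonroot infK delta_neq0.
  by exists (param_point v); apply: param_in.
move=> A B [SA AE] [SB BE] ZAB.
have cover S : (forall f, S f -> vanishing_ideal Z f) \/
    (exists2 f, S f & ~ vanishing_ideal Z f).
  have [h|/existsNP[f /not_implyP[Sf nf]]] := EM (forall f, S f -> vanishing_ideal Z f).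
    by left.
  by right; exists f.
have [hA|[f SAf nf]] := cover SA.
  by left => x Zx; apply/AE => f Sf; apply: hA.
have [hB|[g SBg ng]] := cover SB.
  by right => x Zx; apply/BE => g Sg; apply: hB.
suff /param_ideal_prime[/nf|/ng] : vanishing_ideal Z (f * g) by [].
move=> x /ZAB[/AE|/BE] h; rewrite /peval rmorphM /=.
  by rewrite -/(peval f x) h // mul0r.
by rewrite -/(peval g x) h // mulr0.
Qed.

(** The coordinates recovered by [idx] are independent on Z, and by density any
    relation between rational functions in e variables descends to Z. *)
Lemma param_has_dim : has_dim Z e.
Proof.
split.
  exists [tuple 'X_(idx k) | k < e] => g gZ.
  have : g * delta = 0.
    apply/eqP/negPn/negP => /(mpoly_nonroot infK)[v].
    rewrite rmorphM mulf_eq0 negb_or => /andP[gv dv]; case/negP: gv.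
    have := gZ _ (param_in dv); rewrite /peval comp_mpoly_meval => <-; apply/eqP.
    by apply: meval_eq => k; rewrite tnth_mktuple mevalXU param_coord.
  by move/eqP; rewrite mulf_eq0 (negbTE delta_neq0) orbF => /eqP.
move=> r s indep; rewrite leqNgt; apply/negP => er.
pose N := (\sum_(k < r) msize (tnth s k))%N.
have sN k : (msize (tnth s k) <= N)%N by rewrite /N (bigD1 k) //= leq_addr.
have [P PE] : exists P : 'I_r -> {mpoly K[e]}, forall k v, delta.@[v] != 0 ->
    peval (tnth s k) (param_point v) = (P k).@[v] / (delta ^+ N).@[v].
  by apply: (fin_all_exists (fun k => peval_param (sN k))).
have [g g0 gP] := rational_functions_dependent P (delta ^+ N) er.
case/eqP: g0; apply: indep; apply: param_dense => v dv.
rewrite /peval comp_mpoly_meval -[RHS](gP v); last by rewrite rmorphXn expf_neq0.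
by apply: meval_eq => k; rewrite -PE.
Qed.
End RationalParametrisation.

(** * Nonsingular points of an irreducible set *)

Section IrreducibleNonsingular.
Variables (K : fieldType) (d e : nat) (Z : 'rV[K]_d -> Prop).
Hypotheses (Zirr : irreducible_closed Z) (Zdim : has_dim Z e).

Lemma component_of_irreducible Y : irreducible_component Z Y -> forall x, Y x <-> Z x.
Proof. by move=> [_ YZ maxY] x; split; [apply: YZ | apply: maxY]. Qed.

Lemma has_dim_component Y r : irreducible_component Z Y -> has_dim Y r -> r = e.
Proof.
move=> cY [[s sY] maxY]; have YZ := component_of_irreducible cY.
have [[t tZ] maxZ] := Zdim.
have ind k (u : k.-tuple _) : alg_independent_on Y u <-> alg_independent_on Z u.
  by split=> h g hg; apply: h => x /YZ; apply: hg.
by apply/eqP; rewrite eqn_leq (maxZ _ s) ?(maxY _ t) //; apply/ind.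
Qed.

(** An irreducible set is its own unique component, so its local dimension at each
    of its points is its dimension. *)
Lemma nonsingular_irreducible p T : Z p -> is_tangent_space Z p T ->
  nonsingular_point Z p <-> \dim T = e.
Proof.
move=> Zp TP.
have compZ : irreducible_component Z Z by split=> // Y' _ _.
split=> [[_ [r [T' [[[Y [cY _ dY]] _] T'P dT']]]]|dT].
  rewrite -(has_dim_component cY dY) -dT'.
  have -> : T = T' by apply/vspaceP => v; apply/idP/idP => [/TP/T'P|/T'P/TP].
  by [].
split=> //; exists e, T; split=> //; split; first by exists Z.
by move=> Y r cY _ dY; rewrite (has_dim_component cY dY).
Qed.
End IrreducibleNonsingular.

Section CoordinateSubspace.
Variables (K : fieldType) (d : nat).

Definition coord_space (P : {pred 'I_d}) : {vspace 'rV[K]_d} :=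
  <<[seq delta_mx ord0 i | i <- enum P]>>%VS.

Lemma coord_spaceP P (v : 'rV[K]_d) :
  reflect (forall i, i \notin P -> v 0 i = 0) (v \in coord_space P).
Proof.
apply: (iffP idP) => [vP i iP|v0].
  have : (coord_space P <= lker (linfun (fun w : 'rV[K]_d => col i w)))%VS.
    apply/span_subvP => w /mapP[j]; rewrite mem_enum => jP ->.
    rewrite memv_ker lfunE /=; apply/eqP/matrixP => a b; rewrite !mxE.
    by rewrite andbC; case: eqP => // eij; rewrite eij jP in iP.
  move/subvP/(_ _ vP); rewrite memv_ker lfunE /= => /eqP/matrixP/(_ 0 0).
  by rewrite !mxE.
rewrite (row_sum_delta v) (bigID (mem P)) /= [X in _ + X]big1 ?addr0; last first.
  by move=> i /v0 ->; rewrite scale0r.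
apply: rpred_sum => i iP; apply/rpredZ/memv_span.
by apply: map_f; rewrite mem_enum.
Qed.

Lemma dim_coord_space P : \dim (coord_space P) = #|P|.
Proof.
pose X : seq ('rV[K]_d) := [seq delta_mx 0 i | i <- enum P].
have sX : size X = #|P| by rewrite size_map cardE.
apply/eqP; rewrite -sX; change (free X).
apply/(@freeP _ _ _ (in_tuple X)) => k k0 i.
have iP : (i < size (enum P))%N by rewrite -(size_map (fun i => delta_mx (0 : 'I_1) i : 'rV[K]_d)).
have x0 : 'I_d by case: (enum P) iP.
have nthX j : (j < size (enum P))%N -> X`_j = delta_mx 0 (nth x0 (enum P) j).
  by move=> h; rewrite (nth_map x0).
have := congr1 (fun w : 'rV[K]_d => w 0 (nth x0 (enum P) i)) k0.
rewrite summxE mxE (bigD1 i) //= big1 ?addr0 => [|j ji].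
  by rewrite mxE nthX // mxE !eqxx mulr1.
have jP : (j < size (enum P))%N by rewrite -(size_map (fun i => delta_mx (0 : 'I_1) i : 'rV[K]_d)).
by rewrite mxE nthX // mxE nth_uniq ?enum_uniq // eq_sym (inj_eq val_inj) (negbTE ji) mulr0.
Qed.
End CoordinateSubspace.

(** * Derivatives along rational curves *)

Section Velocity.
Variables (K : fieldType) (infK : infinite_field K).
Implicit Types (phi psi : K -> K) (v w c : K).

(** phi is, up to finitely many values of t, a rational function that is regular at
    0, and v is its derivative there.  Stating this for functions rather than for
    fractions lets curves be given by any formula, including one with inverses. *)
Definition has_velocity phi v : Prop :=
  exists Q R : {poly K}, Q.[0] != 0 /\
    forall t, Q.[t] != 0 -> phi t * Q.[t] = (phi 0 + v * t) * Q.[t] + t ^+ 2 * R.[t].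

Lemma velocity_ext phi psi v : phi =1 psi -> has_velocity phi v -> has_velocity psi v.
Proof. by move=> e [Q [R [Q0 E]]]; exists Q, R; split=> // t /E; rewrite !e. Qed.

Lemma velocity_cst c : has_velocity (fun _ => c) 0.
Proof.
exists 1, 0; rewrite hornerE oner_neq0; split=> // t _.
by rewrite !hornerE; ring.
Qed.

Lemma velocity_line c v : has_velocity (fun t => c + t * v) v.
Proof.
exists 1, 0; rewrite hornerE oner_neq0; split=> // t _.
by rewrite !hornerE; ring.
Qed.

Lemma velocityD phi psi v w : has_velocity phi v -> has_velocity psi w ->
  has_velocity (fun t => phi t + psi t) (v + w).
Proof.
move=> [Q [R [Q0 E]]] [Q' [R' [Q'0 E']]].
exists (Q * Q'), (R * Q' + R' * Q); split=> [|t]; first by rewrite hornerM mulf_neq0.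
rewrite hornerM mulf_eq0 negb_or => /andP[/E h /E' h'].
transitivity (phi t * Q.[t] * Q'.[t] + psi t * Q'.[t] * Q.[t]); first by ring.
by rewrite h h' !hornerE /=; ring.
Qed.

Lemma velocityM phi psi v w : has_velocity phi v -> has_velocity psi w ->
  has_velocity (fun t => phi t * psi t) (v * psi 0 + phi 0 * w).
Proof.
move=> [Q [R [Q0 E]]] [Q' [R' [Q'0 E']]].
exists (Q * Q'), ((v * w)%:P * Q * Q' + R * (((psi 0)%:P + w *: 'X) * Q' + 'X^2 * R')
   + ((phi 0)%:P + v *: 'X) * Q * R').
split=> [|t]; first by rewrite hornerM mulf_neq0.
rewrite hornerM mulf_eq0 negb_or => /andP[/E h /E' h'].
by rewrite mulrACA h h' !hornerE /=; ring.
Qed.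

Lemma velocityV phi v : phi 0 != 0 -> has_velocity phi v ->
  has_velocity (fun t => (phi t)^-1) (- v / phi 0 ^+ 2).
Proof.
move=> c0 [Q [R [Q0 E]]]; set c := phi 0 in c0 E *.
have [S SP] : exists S : {poly K}, forall t, S.[t] = (c + v * t) * Q.[t] + t ^+ 2 * R.[t].
  by exists ((c%:P + v *: 'X) * Q + 'X^2 * R) => t; rewrite !hornerE.
have SE t : Q.[t] != 0 -> S.[t] = phi t * Q.[t] by move=> /E ->.
exists (Q * S), (Q * ((v ^+ 2 / c ^+ 2)%:P * Q - ((c^-1)%:P - (v / c ^+ 2) *: 'X) * R)).
split=> [|t]; first by rewrite hornerM mulf_neq0 // SE // mulf_neq0.
rewrite hornerM mulf_eq0 negb_or => /andP[Qt St].
have p0 : phi t != 0 by move: St; rewrite SE // mulf_eq0 negb_or => /andP[].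
transitivity (Q.[t] ^+ 2); first by rewrite SE //=; field.
by rewrite SP !hornerE /= -/c; field.
Qed.

Lemma velocity_sum (I : Type) (r : seq I) (P : pred I) (phi : I -> K -> K) (v : I -> K) :
  (forall i, P i -> has_velocity (phi i) (v i)) ->
  has_velocity (fun t => \sum_(i <- r | P i) phi i t) (\sum_(i <- r | P i) v i).
Proof.
move=> h; elim: r => [|i r IH].
  by rewrite big_nil; apply: velocity_ext (velocity_cst 0) => t; rewrite big_nil.
rewrite big_cons; case: (boolP (P i)) => Pi.
  by apply: velocity_ext (velocityD (h i Pi) IH) => t; rewrite big_cons Pi.
by apply: velocity_ext IH => t; rewrite big_cons (negbTE Pi).
Qed.

Definition generically (A : K -> Prop) : Prop :=
  exists2 D : {poly K}, D != 0 & forall t, D.[t] != 0 -> A t.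

Lemma generically_and A B :
  generically A -> generically B -> generically (fun t => A t /\ B t).
Proof.
move=> [D D0 hD] [F F0 hF]; exists (D * F); first by rewrite mulf_neq0.
by move=> t; rewrite hornerM mulf_eq0 negb_or => /andP[/hD ? /hF].
Qed.

Lemma generically_sub (A B : K -> Prop) :
  (forall t, A t -> B t) -> generically A -> generically B.
Proof. by move=> AB [D D0 hD]; exists D => // t /hD/AB. Qed.

Lemma generically_neq0 : generically (fun t => t != 0).
Proof. by exists 'X; rewrite ?polyX_eq0 // => t; rewrite hornerX. Qed.

(** The numerator of phi, written so that its coefficients of degree 0 and 1 can be
    read off. *)
Lemma velocity_numerator phi v : has_velocity phi v ->
  exists Q W R : {poly K}, [/\ Q.[0] != 0, W = ((phi 0)%:P + v *: 'X) * Q + 'X * ('X * R)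
    & forall t, Q.[t] != 0 -> phi t * Q.[t] = W.[t]].
Proof.
move=> [Q [R [Q0 E]]]; exists Q, (((phi 0)%:P + v *: 'X) * Q + 'X * ('X * R)), R.
by split=> // t /E ->; rewrite !(hornerD, hornerM, hornerC, hornerZ, hornerX); ring.
Qed.

Lemma velocity_neq0 phi v : has_velocity phi v -> phi 0 != 0 ->
  generically (fun t => phi t != 0).
Proof.
move=> /velocity_numerator[Q [W [R [Q0 WE E]]]] c0; exists (Q * W).
  apply: contraTneq (mulf_neq0 Q0 (mulf_neq0 c0 Q0)) => /(congr1 (fun p => p.[0])).
  by rewrite hornerM WE !hornerE negbK => ->.
by move=> t; rewrite hornerM mulf_eq0 negb_or => /andP[/E <-]; rewrite mulf_eq0 negb_or => /andP[].
Qed.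

(** A rational function with infinitely many zeros is 0, hence so are its value and
    its derivative at 0. *)
Lemma velocity_eq0 phi v : has_velocity phi v -> generically (fun t => phi t = 0) ->
  phi 0 = 0 /\ v = 0.
Proof.
move=> /velocity_numerator[Q [W [R [Q0 WE E]]]] [D D0 phi0].
have W0 : W = 0.
  have QN : Q != 0 by apply: contraNneq Q0 => ->; rewrite horner0.
  apply/eqP/negPn/negP => WN.
  have [t] := poly_nonroot infK (mulf_neq0 (mulf_neq0 QN D0) WN).
  rewrite !hornerM !mulf_eq0 !negb_or => /andP[/andP[Qt Dt]].
  by rewrite -E // phi0 // mul0r eqxx.
have c0 : phi 0 = 0.
  have := congr1 (fun p : {poly K} => p.[0]) WE.
  by rewrite W0 !hornerE => /esym/eqP; rewrite mulf_eq0 (negbTE Q0) orbF => /eqP.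
split=> //; have /esym/eqP : 0 = 'X * (v *: Q + 'X * R).
  by rewrite -[LHS]W0 WE c0 -!mul_polyC; ring.
rewrite mulf_eq0 polyX_eq0 => /eqP/(congr1 (fun p : {poly K} => p.[0])).
by rewrite !hornerE => /eqP; rewrite mulf_eq0 (negbTE Q0) orbF => /eqP.
Qed.

Lemma velocity_unique phi v w : has_velocity phi v -> has_velocity phi w -> v = w.
Proof.
move=> hv hw; have hd := velocityD hv (velocityM (velocity_cst (-1)) hw).
have [|_ /eqP] := velocity_eq0 hd.
  by exists 1; rewrite ?oner_neq0 // => t _; rewrite mulN1r subrr.
by rewrite mul0r add0r mulN1r subr_eq0 => /eqP.
Qed.

Definition curve_velocity d (gam : K -> 'rV[K]_d) (v : 'rV[K]_d) : Prop :=
  forall i, has_velocity (fun t => gam t 0 i) (v 0 i).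

(** The chain rule, checked on variables and propagated by the Leibniz rule. *)
Lemma velocity_peval d (gam : K -> 'rV[K]_d) (v : 'rV[K]_d) (g : {mpoly K[d]}) :
  curve_velocity gam v ->
  has_velocity (fun t => peval g (gam t)) (\sum_(i < d) peval g^`M(i) (gam 0) * v 0 i).
Proof.
move=> gv; pose P g := has_velocity (fun t => peval g (gam t))
  (\sum_(i < d) peval g^`M(i) (gam 0) * v 0 i).
have PC c : P c%:MP.
  rewrite /P big1 => [|i _]; last by rewrite mderivC /peval meval0 mul0r.
  by apply: velocity_ext (velocity_cst c) => t; rewrite /peval mevalC.
have PX i : P 'X_i.
  rewrite /P (bigD1 i) //= big1 ?addr0 => [|j ji].
    rewrite mderivX mnmE eqxx /peval mevalZ mul1r.
    rewrite (_ : (U_(i) - U_(i))%MM = 0%MM) ?mpolyX0 ?meval1 ?mul1r; last first.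
      by apply/mnmP => j; rewrite !mnmE subnn.
    by apply: velocity_ext (gv i) => t; rewrite mevalXU.
  by rewrite mderivX mnmE eq_sym (negbTE ji) scale0r /peval meval0 mul0r.
have PD f h : P f -> P h -> P (f + h).
  move=> hf hh; rewrite /P; have := velocityD hf hh; rewrite -big_split /=.
  under eq_bigr => i _ do rewrite -mulrDl /peval -mevalD -mderivD.
  by apply: velocity_ext => t; rewrite /peval mevalD.
have PM f h : P f -> P h -> P (f * h).
  move=> hf hh; rewrite /P; have := velocityM hf hh.
  rewrite mulr_suml mulr_sumr -big_split /=.
  under eq_bigr => i _ do rewrite mulrAC mulrA -mulrDl /peval -!mevalM -mevalD -mderivM.
  by apply: velocity_ext => t; rewrite /peval mevalM.
suff : P g by [].
rewrite (mpolyE g); apply: (big_ind P) => [||m _]; first 1 last; first exact: PD.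
  rewrite -mul_mpolyC; apply: (PM _ _) => //; rewrite mpolyXE_id.
  apply: (big_ind P) => [||i _]; [by rewrite -mpolyC1 | exact: (PM) |].
  by elim: (m i) => [|k IH]; rewrite ?expr0 -?mpolyC1 // exprS; apply: PM.
by rewrite -mpolyC0.
Qed.

(** The link between curves and ideals: the value gives density statements, the
    derivative gives tangent vectors. *)
Lemma generic_curve_limit d (Z : 'rV[K]_d -> Prop) (gam : K -> 'rV[K]_d) (v : 'rV[K]_d) g :
  curve_velocity gam v -> generically (fun t => Z (gam t)) -> vanishing_ideal Z g ->
  peval g (gam 0) = 0 /\ \sum_(i < d) peval g^`M(i) (gam 0) * v 0 i = 0.
Proof.
move=> gv gZ gI; apply: (velocity_eq0 (velocity_peval g gv)).
by apply: generically_sub gZ => t; apply: gI.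
Qed.
End Velocity.

(** * Lower unipotent matrices and the nilpotent block *)

Section LowerUnipotent.
Variables (K : fieldType) (n : nat).
Implicit Types (u : 'M[K]_n) (y : 'cV[K]_n).

Lemma lower_unipotent_det u : lower_unipotent u -> \det u = 1.
Proof.
move=> [lu du]; rewrite det_trig; first by rewrite big1.
by apply/is_trig_mxP.
Qed.

Lemma lower_unipotent_unit u : lower_unipotent u -> u \in unitmx.
Proof. by move=> /lower_unipotent_det du; rewrite unitmxE du unitr1. Qed.

Lemma lower_mul_eq0 u y m : lower_triangular u ->
  (forall i : 'I_n, (i < m)%N -> y i 0 = 0) ->
  forall i : 'I_n, (i < m)%N -> (u *m y) i 0 = 0.
Proof.
move=> lu y0 i im; rewrite mxE big1 // => j _.
case: (leqP j i) => ij; last by rewrite lu // mul0r.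
by rewrite y0 ?mulr0 //; apply: leq_ltn_trans ij im.
Qed.

(** The inverse of u is lower triangular too; forward substitution avoids
    computing it. *)
Lemma unipotent_mul_inj0 u y m : lower_unipotent u ->
  (forall i : 'I_n, (i < m)%N -> (u *m y) i 0 = 0) ->
  forall i : 'I_n, (i < m)%N -> y i 0 = 0.
Proof.
move=> [lu du] uy0 i; have [k] := ubnP (i : nat); elim: k i => // k IH i ik im.
have := uy0 i im; rewrite mxE (bigD1 i) //= du mul1r big1 ?addr0 // => j ji.
case: (ltngtP j i) => ij.
- by rewrite IH ?mulr0 //; lia.
- by rewrite lu // mul0r.
- by case/eqP: ji; apply: val_inj.
Qed.

Lemma nilpotent_mul q (x : 'M[K]_(n, q)) (i k : 'I_n) j : k = i.+1 :> nat ->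
  (nilpotent_block K n *m x) i j = x k j.
Proof.
move=> ki; rewrite mxE (bigD1 k) //= mxE ki eqxx mul1r big1 ?addr0 // => l lk.
by rewrite mxE -ki (inj_eq val_inj) (negbTE lk) mul0r.
Qed.

Lemma nilpotent_mul_last q (x : 'M[K]_(n, q)) (i : 'I_n) j : i.+1 = n ->
  (nilpotent_block K n *m x) i j = 0.
Proof.
move=> iN; rewrite mxE big1 // => k _; rewrite mxE iN.
by rewrite (ltn_eqF (ltn_ord k)) mul0r.
Qed.

End LowerUnipotent.

Section ShiftCoordinates.
Variables (K : fieldType) (n : nat) (z : 'I_n).
Hypothesis z0 : z = 0%N :> nat.
Notation N := (nilpotent_block K n).
Implicit Types (u : 'M[K]_n) (a : 'cV[K]_n).

Definition shift_coords u : 'cV[K]_n := invmx u *m (N *m col z u).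

Lemma shift_coordsP u a : u \in unitmx -> (u *m a = N *m col z u) <-> a = shift_coords u.
Proof.
move=> uU; split=> [E|->]; first by rewrite /shift_coords -E mulKmx.
by rewrite mulKVmx.
Qed.

Lemma mul_shift_coords u : u \in unitmx -> u *m shift_coords u = N *m col z u.
Proof. by move=> uU; apply/shift_coordsP. Qed.

Lemma shift_coords_z u (o1 : 'I_n) : lower_unipotent u -> o1 = 1%N :> nat ->
  shift_coords u z 0 = u o1 z.
Proof.
move=> uu o11; have := mul_shift_coords (lower_unipotent_unit uu).
move/matrixP/(_ z 0); rewrite (@nilpotent_mul _ _ _ _ _ o1) ?z0 // [RHS]mxE => <-.
case: uu => lu du; rewrite [RHS]mxE (bigD1 z) //= du mul1r big1 ?addr0 // => j jz.
rewrite lu ?mul0r // z0 lt0n; apply: contraNneq jz => j0.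
by apply/eqP/val_inj; rewrite /= j0 z0.
Qed.

Lemma shift_coords_1 u (o1 o2 : 'I_n) : lower_unipotent u ->
  o1 = 1%N :> nat -> o2 = 2%N :> nat ->
  shift_coords u o1 0 = u o2 z - u o1 z ^+ 2.
Proof.
move=> uu o11 o22; have := mul_shift_coords (lower_unipotent_unit uu).
move/matrixP/(_ o1 0); rewrite (@nilpotent_mul _ _ _ _ _ o2) ?o11 // [RHS]mxE => <-.
rewrite [in RHS]mxE (bigD1 z) // (bigD1 o1) /=; last by rewrite -val_eqE /= o11 z0.
rewrite (shift_coords_z uu o11); case: (uu) => lu ->; rewrite big1 => [|j /andP[jz j1]].
  by ring.
rewrite lu ?mul0r //; move: jz j1; rewrite -!val_eqE /= z0 o11; lia.
Qed.

(** The hypothesis says N c_1 = b c_1; nilpotency forces b = 0, and then c_1 = e_1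
    because e_1 spans the kernel of N. *)
Lemma shift_coords_eq0_col u : lower_unipotent u ->
  (forall i : 'I_n, i != z -> shift_coords u i 0 = 0) ->
  forall i : 'I_n, i != z -> u i z = 0.
Proof.
move=> uu a0; have := mul_shift_coords (lower_unipotent_unit uu).
set b := shift_coords u z 0.
have -> : u *m shift_coords u = b *: col z u.
  apply/colP => i; rewrite !mxE (bigD1 z) //= big1 => [|j jz]; last by rewrite a0 ?mulr0.
  by rewrite addr0 mulrC.
case: uu => lu du E.
have step (i k : 'I_n) : k = i.+1 :> nat -> u k z = b * u i z.
  move=> ki; have /matrixP/(_ i 0) := E.
  by rewrite (nilpotent_mul _ _ ki) !mxE.
(* The eigenvector equation makes c_1 the sequence of the powers of b. *)
have pw (i : 'I_n) : u i z = b ^+ i.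
  have [k] := ubnP (i : nat); elim: k i => // k IH i ik.
  case: (posnP i) => [i0|i0].
    by rewrite i0 expr0 (_ : i = z) ?du //; apply: val_inj; rewrite /= z0.
  have lt : (i.-1 < n)%N by apply: leq_ltn_trans (leq_pred i) _.
  by rewrite (step (Ordinal lt)) /= ?prednK // IH /= -?exprS prednK //; lia.
have bn : b = 0.
  have lt : (n.-1 < n)%N by rewrite prednK // (leq_trans _ (ltn_ord z)).
  have /matrixP/(_ (Ordinal lt) 0) := E.
  rewrite nilpotent_mul_last ?[LHS]mxE /= ?prednK ?(leq_trans _ (ltn_ord z)) //.
  by rewrite mxE pw /= -exprS => /eqP; rewrite expf_eq0 => /andP[_ /eqP].
move=> i iz; rewrite pw bn expr0n; case: eqP => // i0.
by case/eqP: iz; apply: val_inj; rewrite /= i0 z0.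
Qed.

End ShiftCoordinates.

(** * The Hessenberg equations in the opposite cell *)

Section MatrixVelocity.
Variables (K : fieldType).

Definition mx_velocity p q (U : K -> 'M[K]_(p, q)) (V : 'M[K]_(p, q)) : Prop :=
  forall i j, has_velocity (fun t => U t i j) (V i j).

Lemma mx_velocity_line p q (U V : 'M[K]_(p, q)) : mx_velocity (fun t => U + t *: V) V.
Proof. by move=> i j; apply: velocity_ext (velocity_line _ _) => t; rewrite !mxE. Qed.

Lemma mx_velocity_mul p q r (A : K -> 'M[K]_(p, q)) (B : K -> 'M[K]_(q, r)) A' B' :
  mx_velocity A A' -> mx_velocity B B' ->
  mx_velocity (fun t => A t *m B t) (A' *m B 0 + A 0 *m B').
Proof.
move=> hA hB i j; rewrite !mxE -big_split.
have h := @velocity_sum _ _ (index_enum _) predT _ _ (fun k _ => velocityM (hA i k) (hB k j)).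
by apply: velocity_ext h => t; rewrite !mxE.
Qed.

Lemma curve_velocity_mxvec n (U : K -> 'M[K]_n) V :
  mx_velocity U V -> curve_velocity (fun t => mxvec (U t)) (mxvec V).
Proof.
move=> h k; case/mxvec_indexP: k => i j; rewrite mxvecE.
by apply: velocity_ext (h i j) => t; rewrite mxvecE.
Qed.
End MatrixVelocity.

Definition tail_col (R : nmodType) n m (a : 'cV[R]_n) : 'cV[R]_n :=
  \col_i (if (m <= i)%N then a i 0 else 0).

Section HessenbergCell.
Variables (K : fieldType) (n m : nat) (z : 'I_n).
Hypothesis z0 : z = 0%N :> nat.
Notation N := (nilpotent_block K n).
Implicit Types (u v : 'M[K]_n) (a : 'cV[K]_n).

(** The adjugate replaces the inverse, so that the coordinates are polynomials; they
    agree with [shift_coords] where the determinant is 1. *)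
Definition poly_shift_coords e (U : 'M[{mpoly K[e]}]_n) : 'cV_n :=
  \adj U *m (map_mx (@mpolyC e K) N *m col z U).

Lemma poly_shift_coordsE e (U : 'M[{mpoly K[e]}]_n) (x : 'I_e -> K) i :
  lower_unipotent (map_mx (meval x) U) ->
  (poly_shift_coords U i 0).@[x] = shift_coords z (map_mx (meval x) U) i 0.
Proof.
move=> uu.
have -> : (poly_shift_coords U i 0).@[x] = map_mx (meval x) (poly_shift_coords U) i 0.
  by rewrite [RHS]mxE.
rewrite /shift_coords /invmx lower_unipotent_unit // lower_unipotent_det //.
rewrite invr1 scale1r !map_mxM map_mx_adj map_col; congr ((_ *m (_ *m _)) _ _).
by apply/matrixP => j k; rewrite !mxE [LHS]mevalC.
Qed.

Definition generic_mx : 'M[{mpoly K[n * n]}]_n := \matrix_(i, j) 'X_(mxvec_index i j).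

Lemma generic_mxE u : map_mx (meval (fun i => mxvec u 0 i)) generic_mx = u.
Proof. by apply/matrixP => i j; rewrite !mxE mevalXU mxvecE. Qed.

Definition shift_poly i := poly_shift_coords generic_mx i 0.

Lemma peval_shift_poly u i : lower_unipotent u ->
  peval (shift_poly i) (mxvec u) = shift_coords z u i 0.
Proof. by move=> uu; rewrite /peval poly_shift_coordsE generic_mxE. Qed.

Definition on_hess u : Prop :=
  lower_unipotent u /\ forall i : 'I_n, (m <= i)%N -> shift_coords z u i 0 = 0.

Definition hess_cell (x : 'rV[K]_(n * n)) : Prop := on_hess (vec_mx x).

Lemma hess_cell_closed : zariski_closed hess_cell.
Proof.
exists (fun f => [\/ exists i j : 'I_n, (i < j)%N /\ f = 'X_(mxvec_index i j),
    exists i : 'I_n, f = 'X_(mxvec_index i i) - 1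
  | exists i : 'I_n, (m <= i)%N /\ f = shift_poly i]).
move=> x; rewrite -[x]vec_mxK /hess_cell mxvecK; set u := vec_mx x; split.
  move=> [uu az] f [[i [j [ij ->]]]|[i ->]|[i [mi ->]]].
  - by rewrite /peval mevalXU mxvecE; apply: uu.1.
  - by rewrite /peval mevalB mevalXU meval1 mxvecE uu.2 subrr.
  - by rewrite peval_shift_poly // az.
move=> h; have uu : lower_unipotent u.
  split=> [i j ij|i].
    rewrite -(mxvecE u) -(mevalXU (fun k => mxvec u 0 k)); apply: h.
    by apply: Or31; exists i, j.
  apply/eqP; rewrite -subr_eq0 -(mxvecE u) -(mevalXU (fun k => mxvec u 0 k)).
  rewrite -[X in _ - X](meval1 (fun k => mxvec u 0 k)) -mevalB; apply/eqP/h.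
  by apply: Or32; exists i.
split=> // i mi; rewrite -peval_shift_poly //; apply: h.
by apply: Or33; exists i.
Qed.

(** With r the part of N c_1 along the columns of index at least m, adding
    r / a_k to column k absorbs r into the term a_k c_k.  Nothing else changes,
    since r is supported in rows of index at least m and k is not the first
    column. *)
Definition hess_retraction (k : 'I_n) u : 'M[K]_n :=
  u + (shift_coords z u k 0)^-1 *: (u *m tail_col m (shift_coords z u) *m delta_mx 0 k).

Lemma hess_retractionE k u (i j : 'I_n) : hess_retraction k u i j =
  u i j + (shift_coords z u k 0)^-1 * ((u *m tail_col m (shift_coords z u)) i 0 * (j == k)%:R).
Proof.
rewrite /hess_retraction; move: (u *m _) => y; rewrite mxE [X in _ + X]mxE.
by rewrite [(y *m _) _ _]mxE big_ord1 [delta_mx _ _ _ _]mxE eqxx.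
Qed.

Lemma tail_mul_eq0 u a (i : 'I_n) : lower_triangular u -> (i < m)%N -> (u *m tail_col m a) i 0 = 0.
Proof.
move=> lu; apply: (lower_mul_eq0 lu) => j jm.
by rewrite mxE leqNgt jm.
Qed.

Lemma hess_retraction_unipotent (k : 'I_n) u : (k < m)%N -> lower_unipotent u ->
  lower_unipotent (hess_retraction k u).
Proof.
move=> km [lu du]; split=> [i j ij|i]; rewrite hess_retractionE.
  rewrite lu // add0r; case: (eqVneq j k) ij => [-> ij|]; last by rewrite !mulr0.
  by rewrite tail_mul_eq0 ?mul0r ?mulr0 //; apply: ltn_trans km.
rewrite du; case: (eqVneq i k) => [->|]; last by rewrite !mulr0 addr0.
by rewrite tail_mul_eq0 ?mul0r ?mulr0 ?addr0.
Qed.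

(** N c_1 is unchanged, and expands on the new columns with the same first m
    coordinates. *)
Lemma hess_retraction_coords (k : 'I_n) u : k != z -> (k < m)%N -> lower_unipotent u ->
  shift_coords z u k 0 != 0 ->
  shift_coords z (hess_retraction k u) = shift_coords z u - tail_col m (shift_coords z u).
Proof.
move=> kz km uu ak; set a := shift_coords z u in ak *.
have uu' := hess_retraction_unipotent km uu.
apply/esym/shift_coordsP; first exact: lower_unipotent_unit.
have -> : col z (hess_retraction k u) = col z u.
  apply/colP => i; rewrite mxE hess_retractionE [RHS]mxE.
  by rewrite eq_sym (negbTE kz) !mulr0 addr0.
rewrite -(mul_shift_coords z (lower_unipotent_unit uu)) -/a.
have ek : (delta_mx 0 k : 'rV[K]_n) *m (a - tail_col m a) = (a k 0)%:M.
  rewrite -rowE; apply/matrixP => i j; rewrite !ord1 !mxE leqNgt km subr0.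
  by rewrite eqxx mulr1n.
rewrite mulmxDl -scalemxAl -mulmxA ek mul_mx_scalar scalerA mulVf // scale1r.
by rewrite -mulmxDr subrK.
Qed.

Lemma on_hess_retraction (k : 'I_n) u : k != z -> (k < m)%N -> lower_unipotent u ->
  shift_coords z u k 0 != 0 -> on_hess (hess_retraction k u).
Proof.
move=> kz km uu ak; split; first exact: hess_retraction_unipotent.
by move=> i mi; rewrite hess_retraction_coords // !mxE mi subrr.
Qed.

Lemma tail_on_hess u : on_hess u -> tail_col m (shift_coords z u) = 0.
Proof. by move=> [_ a0]; apply/colP => i; rewrite mxE [RHS]mxE; case: ifP => // /a0. Qed.

Lemma hess_retraction_id (k : 'I_n) u : on_hess u -> hess_retraction k u = u.
Proof. by move=> /tail_on_hess a0; rewrite /hess_retraction a0 mulmx0 mul0mx scaler0 addr0. Qed.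

Definition strictly_lower v : Prop := forall i j : 'I_n, (i <= j)%N -> v i j = 0.

Lemma lower_unipotent_line u v t : lower_unipotent u -> strictly_lower v ->
  lower_unipotent (u + t *: v).
Proof.
move=> [lu du] sv; split=> [i j ij|i]; rewrite mxE [X in _ + X]mxE.
  by rewrite lu // (sv _ _ (ltnW ij)) mulr0 addr0.
by rewrite du (sv _ _ (leqnn i)) mulr0 addr0.
Qed.

(** The derivative of a = u^-1 N c_1 in the direction v, obtained by
    differentiating u a = N c_1. *)
Definition shift_differential u v : 'cV[K]_n :=
  invmx u *m (N *m col z v - v *m shift_coords z u).

Hypothesis infK : infinite_field K.

(** The coordinates are polynomials in the entries, so they have some velocity b;
    the equation u a = N c_1 then determines it. *)
Lemma velocity_shift_coords (U : K -> 'M[K]_n) V : (forall t, lower_unipotent (U t)) ->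
  mx_velocity U V ->
  mx_velocity (fun t => shift_coords z (U t)) (shift_differential (U 0) V).
Proof.
move=> uU hU.
have [b hb] : exists b, mx_velocity (fun t => shift_coords z (U t)) b.
  exists (\col_i \sum_k peval (shift_poly i)^`M(k) (mxvec (U 0)) * mxvec V 0 k).
  move=> i j; rewrite ord1 mxE.
  have := velocity_peval (shift_poly i) (curve_velocity_mxvec hU).
  by apply: velocity_ext => t; rewrite peval_shift_poly.
suff <- : b = shift_differential (U 0) V by [].
have uU0 := lower_unipotent_unit (uU 0).
have E : V *m shift_coords z (U 0) + U 0 *m b = N *m col z V.
  apply/matrixP => i j; apply: (velocity_unique infK (mx_velocity_mul hU hb i j)).
  have cN : mx_velocity (fun _ : K => N) 0 by move=> ? ?; rewrite [X in has_velocity _ X]mxE; apply: velocity_cst.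
  have cU : mx_velocity (fun t => col z (U t)) (col z V).
    by move=> a b'; rewrite mxE; apply: velocity_ext (hU a z) => t; rewrite mxE.
  have := mx_velocity_mul cN cU i j; rewrite mul0mx add0r.
  by apply: velocity_ext => t; rewrite mul_shift_coords // lower_unipotent_unit.
by rewrite /shift_differential -E addrC addKr mulKmx.
Qed.

(** If v kills the differentials of the equations, the correction term of the
    retraction vanishes to second order along u + t v, so v is the velocity of a
    curve that stays in the Hessenberg set. *)
Lemma mx_velocity_retraction (k : 'I_n) u v : k != z -> (k < m)%N -> on_hess u ->
  shift_coords z u k 0 != 0 -> strictly_lower v ->
  exists2 w, mx_velocity (fun t => hess_retraction k (u + t *: v)) w
    & (forall i : 'I_n, (m <= i)%N -> shift_differential u v i 0 = 0) -> w = v.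
Proof.
move=> kz km hu ak sv; have uu := hu.1.
have hl := mx_velocity_line u v.
have uul t : lower_unipotent (u + t *: v) by apply: lower_unipotent_line.
have ha := velocity_shift_coords uul hl.
rewrite scale0r addr0 in ha.
set b := shift_differential u v in ha *.
have ht : mx_velocity (fun t => tail_col m (shift_coords z (u + t *: v))) (tail_col m b).
  have tE a i j : tail_col m a i j = if (m <= i)%N then a i 0 else 0 by rewrite mxE.
  move=> i j; rewrite tE; case: (boolP (m <= i)%N) => mi.
    by apply: velocity_ext (ha i 0) => t; rewrite tE mi.
  by apply: velocity_ext (velocity_cst 0) => t; rewrite tE (negbTE mi).
have hr := mx_velocity_mul hl ht; rewrite scale0r addr0 tail_on_hess // mulmx0 add0r in hr.
have ak0 : shift_coords z (u + 0 *: v) k 0 != 0 by rewrite scale0r addr0.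
have hV := velocityV ak0 (ha k 0).
have he i j := velocityD (hl i j) (velocityM hV (velocityM (hr i 0) (velocity_cst (j == k)%:R))).
eexists (\matrix_(i, j) _).
  move=> i j; rewrite mxE; apply: velocity_ext (he i j) => t.
  by rewrite hess_retractionE.
move=> b0; have tb : tail_col m b = 0.
  by apply/colP => i; rewrite mxE [RHS]mxE; case: ifP => // /b0.
apply/matrixP => i j; rewrite mxE scale0r addr0 tail_on_hess // tb !mulmx0 !mxE.
by rewrite !(mul0r, mulr0, addr0, add0r).
Qed.

End HessenbergCell.

(** * Tangent vectors as velocities of curves *)

Section Annihilated.
Variables (K : fieldType) (infK : infinite_field K) (d : nat) (Z : 'rV[K]_d -> Prop).
Variable p : 'rV[K]_d.

Definition tangent_vector (v : 'rV[K]_d) : Prop := forall f, vanishing_ideal Z f ->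
  \sum_(i < d) peval f^`M(i) p * v 0 i = 0.

Lemma tangent_vectorD v w : tangent_vector v -> tangent_vector w -> tangent_vector (v + w).
Proof.
move=> hv hw f fI; under eq_bigr => i _ do rewrite mxE mulrDr.
by rewrite big_split /= hv // hw // addr0.
Qed.

Lemma tangent_vectorZ c v : tangent_vector v -> tangent_vector (c *: v).
Proof.
move=> hv f fI; under eq_bigr => i _ do rewrite mxE mulrCA.
by rewrite -mulr_sumr hv // mulr0.
Qed.

Lemma tangent_vector_curve (gam : K -> 'rV[K]_d) v : gam 0 = p ->
  curve_velocity gam v -> generically (fun t => Z (gam t)) -> tangent_vector v.
Proof. by move=> gp gv gZ f fI; rewrite -gp; have [] := generic_curve_limit infK gv gZ fI. Qed.

Lemma tangent_vector_line v f : tangent_vector v -> vanishing_ideal Z f ->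
  has_velocity (fun t => peval f (p + t *: v)) 0.
Proof.
move=> hv fI; have gv : curve_velocity (fun t => p + t *: v) v.
  by move=> i; apply: velocity_ext (velocity_line _ _) => t; rewrite !mxE.
have := velocity_peval f gv; rewrite scale0r addr0 hv //.
Qed.
End Annihilated.

(** Here and below z, o1, o2 and l are the first, second, third and last indices,
    with values 0, 1, 2 and n - 1. *)
Section HessenbergTangent.
Variables (K : fieldType) (infK : infinite_field K) (n m : nat) (z o1 o2 l : 'I_n).
Hypotheses (z0 : z = 0%N :> nat) (o11 : o1 = 1%N :> nat) (o22 : o2 = 2%N :> nat).
Hypotheses (ln : l.+1 = n) (hm : (1 < m < n)%N).
Notation N := (nilpotent_block K n).
Implicit Types (u v : 'M[K]_n).

Lemma velocity_pow k : has_velocity (fun t : K => t ^+ k) (k == 1%N)%:R.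
Proof.
case: k => [|[|k]].
- by apply: velocity_ext (velocity_cst 1) => t; rewrite expr0.
- by apply: velocity_ext (velocity_line 0 1) => t; rewrite add0r mulr1 expr1.
exists 1, 'X^k; rewrite hornerE oner_neq0; split=> // t _.
by rewrite !(hornerC, hornerXn) /= expr0n !mulr1 mul0r !add0r -exprD.
Qed.

(** Given t, b and a vector w, the equation N x = t x + b w with x_0 = 1 has the
    solution x_i = t^i + b (sum of t^(i-1-k) w_k over k < i), provided its last row
    t x_(n-1) + b w_(n-1) = 0 holds.  [axis_col] is this solution for w the second
    column of u, and [axis_corner] is the last entry of w that turns the last row
    into t^n + b c = 0.  The matrix [axis_mx] so obtained satisfies
    N c_1 = t c_1 + b c_2.  Its name refers to the points with c_1 = e_1, where it
    starts from when t = b = 0. *)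
Definition axis_col (t b : K) u (i : 'I_n) : K :=
  t ^+ i + b * \sum_(k < n | (k < i)%N) t ^+ (i.-1 - k) * u k o1.

Definition axis_corner (t c : K) u : K := c - \sum_(k < n | (k < l)%N) t ^+ (l - k) * u k o1.

Definition axis_mx (t b c : K) u : 'M[K]_n :=
  \matrix_(i, j) if j == z then axis_col t b u i
                 else if (i == l) && (j == o1) then axis_corner t c u else u i j.

Lemma axis_colS t b u (i k : 'I_n) : k = i.+1 :> nat ->
  axis_col t b u k = t * axis_col t b u i + b * u i o1.
Proof.
move=> ki; rewrite /axis_col ki /= exprS mulrDr -addrA mulrCA -mulrDr; congr (_ + _ * _).
rewrite (bigD1 i) //= subnn expr0 mul1r addrC; congr (_ + _).
rewrite mulr_sumr; apply: eq_big => [k'|k' /andP[h1 h2]].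
  by rewrite -val_eqE /=; lia.
have lt : (k' < i)%N by move: h1 h2; rewrite -val_eqE /=; lia.
by rewrite mulrA -exprS; congr (_ ^+ _ * _); lia.
Qed.

Lemma axis_mx_unipotent t b c u : lower_unipotent u -> lower_unipotent (axis_mx t b c u).
Proof.
move=> [lu du]; split=> [i j ij|i]; rewrite mxE.
  rewrite ifF; last by rewrite -val_eqE /= z0; lia.
  by rewrite ifF ?lu // -!val_eqE /=; apply/negP; lia.
case: eqP => [->|_].
  by rewrite /axis_col z0 expr0 big1 ?mulr0 ?addr0 // => k; rewrite ltn0.
by rewrite ifF ?du // -!val_eqE /=; apply/negP; lia.
Qed.

Lemma axis_mx_coords t b c u : lower_unipotent u -> t ^+ n + b * c = 0 ->
  shift_coords z (axis_mx t b c u) = t *: delta_mx z 0 + b *: delta_mx o1 0.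
Proof.
move=> uu tbc; have uu' := axis_mx_unipotent t b c uu.
apply/esym/shift_coordsP; first exact: lower_unipotent_unit.
have zo : o1 == z = false by rewrite -val_eqE /= z0 o11.
rewrite mulmxDr -!scalemxAr -!colE; apply/colP => i.
have E : (t *: col z (axis_mx t b c u) + b *: col o1 (axis_mx t b c u)) i 0 =
    t * axis_col t b u i + b * (if i == l then axis_corner t c u else u i o1).
  by rewrite !mxE !eqxx zo andbT.
rewrite E; case: (eqVneq i l) => [->|il].
  rewrite nilpotent_mul_last // /axis_col /axis_corner.
  have -> : \sum_(k < n | (k < l)%N) t ^+ (l - k) * u k o1 =
      t * \sum_(k < n | (k < l)%N) t ^+ (l.-1 - k) * u k o1.
    rewrite mulr_sumr; apply: eq_bigr => k kl; rewrite mulrA -exprS.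
    by congr (_ ^+ _ * _); lia.
  by move: tbc; rewrite -[in t ^+ n]ln exprS => E0; rewrite -[RHS]E0; ring.
have lt : (i.+1 < n)%N.
  by move: il (ltn_ord i); rewrite -val_eqE /=; lia.
rewrite (@nilpotent_mul _ _ _ _ _ (Ordinal lt)) // !mxE eqxx.
by rewrite [RHS](@axis_colS _ _ _ i).
Qed.

Lemma axis_mx_on_hess t b c u : lower_unipotent u -> t ^+ n + b * c = 0 ->
  on_hess m z (axis_mx t b c u) /\ shift_coords z (axis_mx t b c u) o1 0 = b.
Proof.
move=> uu tbc; split; first split.
- exact: axis_mx_unipotent.
- move=> i mi; rewrite axis_mx_coords // !mxE.
  have -> : (i == z) = false by rewrite -val_eqE /= z0; lia.
  have -> : (i == o1) = false by rewrite -val_eqE /= o11; lia.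
  by rewrite !mulr0 addr0.
- rewrite axis_mx_coords // !mxE !eqxx.
  have -> : (o1 == z) = false by rewrite -val_eqE /= z0 o11.
  by rewrite mulr0 add0r mulr1.
Qed.

(** Solutions of t^n + b c = 0 with b = 0 and c equal to a prescribed la at t = 0,
    and with b not identically 0. *)
Definition axis_beta (la t : K) : K := if la == 0 then - t else - (t ^+ n / la).
Definition axis_gamma (la t : K) : K := if la == 0 then t ^+ n.-1 else la.

Let n0 : (0 < n)%N. Proof. by rewrite -ln. Qed.

Lemma axis_relation la t : t ^+ n + axis_beta la t * axis_gamma la t = 0.
Proof.
rewrite /axis_beta /axis_gamma; case: eqVneq => [_|la0].
  by rewrite mulNr -exprS prednK // subrr.
by rewrite mulNr divfK // subrr.
Qed.

Definition axis_curve u t : 'M[K]_n :=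
  axis_mx t (axis_beta (u l o1) t) (axis_gamma (u l o1) t) u.

Lemma axis_curve_on_hess u t : lower_unipotent u ->
  on_hess m z (axis_curve u t) /\ shift_coords z (axis_curve u t) o1 0 = axis_beta (u l o1) t.
Proof. by move=> uu; apply: axis_mx_on_hess => //; apply: axis_relation. Qed.

Lemma axis_beta_neq0 la t : t != 0 -> axis_beta la t != 0.
Proof.
move=> t0; rewrite /axis_beta; case: (eqVneq la 0) => [_|la0]; rewrite oppr_eq0 //.
by rewrite mulf_neq0 ?invr_eq0 ?expf_neq0.
Qed.

Lemma axis_beta0 la : axis_beta la 0 = 0.
Proof. by rewrite /axis_beta expr0n gtn_eqF // mul0r oppr0 if_same. Qed.

Lemma axis_curve0 u : lower_unipotent u -> (forall i, i != z -> u i z = 0) ->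
  axis_curve u 0 = u.
Proof.
move=> [lu du] uz; apply/matrixP => i j; rewrite mxE.
case: (eqVneq j z) => [->|jz].
  rewrite /axis_col axis_beta0 mul0r addr0 expr0n.
  case: (eqVneq i z) => [->|iz]; first by rewrite z0 du.
  have -> : (i == 0%N :> nat) = false by rewrite -z0 val_eqE (negbTE iz).
  by rewrite uz.
case: ifP => // /andP[/eqP -> /eqP ->].
rewrite /axis_corner big1 ?subr0 => [|k kl].
  rewrite /axis_gamma; case: eqVneq => [->|//].
  by rewrite expr0n -ln /= gtn_eqF //; lia.
by rewrite expr0n subn_eq0 leqNgt kl mul0r.
Qed.

(** Whatever the last entry of c_2, the image under N of the first column of w is e_1
    plus a multiple of c_2: this is the tangent direction that the lines used at
    the points with c_1 = e_1 do not give. *)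
Lemma axis_curve_velocity u : lower_unipotent u -> (forall i, i != z -> u i z = 0) ->
  exists w b, mx_velocity (axis_curve u) w /\
    N *m col z w = col z u + b *: col o1 u.
Proof.
move=> uu uz; set la := u l o1.
pose b : K := if la == 0 then -1 else 0.
have hb : has_velocity (axis_beta la) b.
  have hc := velocityM (velocity_cst (- la^-1)) (velocity_pow n).
  rewrite /b /axis_beta; case: eqVneq => [_|la0].
    by apply: velocity_ext (velocity_line 0 (-1)) => t; rewrite add0r mulrN1.
  rewrite mul0r add0r (_ : (n == 1%N) = false) ?mulr0 in hc; last by lia.
  by apply: velocity_ext hc => t; rewrite mulNr mulrC.
have hg : exists c, has_velocity (axis_gamma la) c.
  rewrite /axis_gamma; case: (la == 0); last by exists 0; apply: velocity_cst.
  by eexists; apply: velocity_pow.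
have {hg} [c hg] := hg.
pose S (i k0 : nat) (t : K) := \sum_(k < n | (k < i)%N) t ^+ (k0 - k) * u k o1.
have hS i k0 : exists s, has_velocity (S i k0) s.
  eexists; exact: (@velocity_sum _ _ (index_enum _) (fun k : 'I_n => (k < i)%N)
    (fun k t => t ^+ (k0 - k) * u k o1) _ (fun k _ => velocityM (velocity_pow (k0 - k)) (velocity_cst (u k o1)))).
have hij (ij : 'I_n * 'I_n) : exists w, has_velocity (fun t => axis_curve u t ij.1 ij.2) w /\
    (ij.2 = z -> w = (ij.1 == 1%N :> nat)%:R + b * S ij.1 ij.1.-1 0).
  case: ij => i j /=; case: (eqVneq j z) => [->|jz].
    have [s hs] := hS i i.-1.
    exists ((i == 1%N :> nat)%:R + b * S i i.-1 0); split=> //.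
    have := velocityD (velocity_pow i) (velocityM hb hs).
    rewrite axis_beta0 mul0r addr0; apply: velocity_ext => t.
    by rewrite mxE eqxx.
  case: (boolP ((i == l) && (j == o1))) => lo.
    have [s hs] := hS l l.
    have := velocityD hg (velocityM (velocity_cst (-1)) hs) => h.
    exists (c + (0 * S l l 0 + -1 * s)); split; last by move=> jz'; rewrite jz' eqxx in jz.
    apply: velocity_ext h => t; rewrite mxE (negbTE jz) lo mulN1r //.
  exists 0; split; last by move=> jz'; rewrite jz' eqxx in jz.
  by apply: velocity_ext (velocity_cst (u i j)) => t; rewrite mxE (negbTE jz) (negbTE lo).
have [w hw] := fin_all_exists hij.
exists (\matrix_(i, j) w (i, j)), b; split.
  by move=> i j; rewrite mxE; have [] := hw (i, j).
(* In the last row, b is nonzero only if the last entry of c_2 is 0. *)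
apply/colP => i; case: (eqVneq i l) => [->|il].
  rewrite nilpotent_mul_last // !mxE uz; last by rewrite -val_eqE /= z0; lia.
  rewrite add0r /b -/la; case: eqVneq => [->|]; by rewrite ?mulr0 ?mul0r.
have lt : (i.+1 < n)%N by move: il (ltn_ord i); rewrite -val_eqE /=; lia.
rewrite (@nilpotent_mul _ _ _ _ _ (Ordinal lt)) // !mxE.
have [_ ->] := hw (Ordinal lt, z) => //=.
rewrite eqSS /S (bigD1 i) //= subnn expr0 mul1r big1 ?addr0 => [|k /andP[k1 k2]].
  congr (_ + _); case: (eqVneq i z) => [->|iz]; first by rewrite z0 uu.2.
  by rewrite uz // -z0 val_eqE (negbTE iz).
rewrite expr0n subn_eq0 [X in X%:R]ifF ?mul0r //.
by move: k1 k2; rewrite -val_eqE /=; lia.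
Qed.

Notation tangent_at u v := (tangent_vector (hess_cell m z) (mxvec u) (mxvec v)).

Lemma tangent_curve u w (gam : K -> 'M[K]_n) : gam 0 = u -> mx_velocity gam w ->
  generically (fun t => on_hess m z (gam t)) -> tangent_at u w.
Proof.
move=> g0 gw gZ; apply: (tangent_vector_curve infK _ (curve_velocity_mxvec gw)).
  by rewrite g0.
by apply: generically_sub gZ => t; rewrite /hess_cell mxvecK.
Qed.

Lemma generically_true (A : K -> Prop) : (forall t, A t) -> generically A.
Proof. by move=> h; exists 1; rewrite ?oner_neq0. Qed.

(** Test v against the entries on and above the diagonal, and against the
    equations of the Hessenberg set. *)
Lemma tangent_hess_necessary u v : on_hess m z u -> tangent_at u v ->
  strictly_lower v /\ forall i : 'I_n, (m <= i)%N -> shift_differential z u v i 0 = 0.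
Proof.
move=> hu tv.
have entry (i j : 'I_n) (c : K) : (forall w, on_hess m z w -> w i j = c) -> v i j = 0.
  move=> wc.
  have fI : vanishing_ideal (hess_cell m z) ('X_(mxvec_index i j) - c%:MP).
    move=> x; rewrite /hess_cell => /wc <-.
    by rewrite /peval mevalB mevalXU mevalC mxE subrr.
  have h := tangent_vector_line tv fI.
  apply: (velocity_unique infK _ h); apply: velocity_ext (velocity_line (u i j - c) _) => t.
  by rewrite /peval mevalB mevalXU mevalC mxE mxvecE [X in _ + X - _]mxE mxvecE addrAC.
have sv : strictly_lower v.
  move=> i j; rewrite leq_eqVlt => /orP[/eqP/val_inj <-|ij].
    by apply: (entry _ _ 1) => w [[]].
  by apply: (entry _ _ 0) => w [[lw _] _]; apply: lw.
split=> // i mi.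
have uul t : lower_unipotent (u + t *: v) by apply: lower_unipotent_line => //; case: hu.
have fI : vanishing_ideal (hess_cell m z) (shift_poly K z i).
  by move=> x [uu az]; rewrite -[x]vec_mxK peval_shift_poly // az.
have := velocity_shift_coords z infK uul (mx_velocity_line u v) i 0.
rewrite scale0r addr0 => h; apply: (velocity_unique infK h).
apply: velocity_ext (tangent_vector_line tv fI) => t.
by rewrite -peval_shift_poly // linearD linearZ.
Qed.

(** At a point with c_1 = e_1 the condition on v is that N v_1 lies in V_m.
    Subtracting a multiple of the velocity w of [axis_curve] removes the e_1
    component of N v_1; what is left is the sum of D, which fixes c_1, and of F,
    which moves only c_1 so that N c_1 = t (a combination of c_2, ..., c_m).  Both
    are directions of lines contained in the Hessenberg set. *)
Lemma tangent_hess_axis u v : on_hess m z u -> (forall i, i != z -> u i z = 0) ->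
  strictly_lower v -> (forall i : 'I_n, (m <= i)%N -> shift_differential z u v i 0 = 0) ->
  tangent_at u v.
Proof.
move=> hu uz sv dv; have uu := hu.1; have uU := lower_unipotent_unit uu.
have cz : N *m col z u = 0.
  apply/colP => i; rewrite [RHS]mxE; case: (eqVneq i l) => [->|il].
    by rewrite nilpotent_mul_last.
  have lt : (i.+1 < n)%N by move: il (ltn_ord i); rewrite -val_eqE /=; lia.
  by rewrite (@nilpotent_mul _ _ _ _ _ (Ordinal lt)) // mxE uz // -val_eqE /= z0.
have a0 : shift_coords z u = 0 by rewrite /shift_coords cz mulmx0.
have dE w : shift_differential z u w = invmx u *m (N *m col z w).
  by rewrite /shift_differential a0 mulmx0 subr0.
have [w [b [hw Nw]]] := axis_curve_velocity uu uz.
have tw : tangent_at u w.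
  apply: (tangent_curve (axis_curve0 uu uz) hw); apply: generically_true => t.
  by have [] := axis_curve_on_hess t uu.
have [sw dw] := tangent_hess_necessary hu tw.
pose c := shift_differential z u v z 0.
have dwz : shift_differential z u w z 0 = 1.
  rewrite dE Nw mulmxDr -scalemxAr !colE !mulKmx // !mxE eqxx.
  have -> : (z == o1) = false by rewrite -val_eqE /= z0 o11.
  by rewrite mulr0 addr0.
pose v' := v - c *: w.
have sv' : strictly_lower v' by move=> i j ij; rewrite 3!mxE sv // sw // mulr0 subrr.
have dv' : shift_differential z u v' = shift_differential z u v - c *: shift_differential z u w.
  rewrite !dE /v' linearB linearZ /= !mulmxBr -!scalemxAr //.
have dv'z : shift_differential z u v' z 0 = 0.
  by rewrite dv' mxE [X in _ + X]mxE [X in - X]mxE dwz mulr1 subrr.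
pose F := col z v' *m (delta_mx 0 z : 'rV_n); pose D := v' - F.
have FE i j : F i j = v' i z * (j == z)%:R.
  by rewrite /F mxE big_ord1 !mxE eqxx.
have tF : tangent_at u F.
  apply: (tangent_curve _ (mx_velocity_line u F)); first by rewrite scale0r addr0.
  have sF : strictly_lower F.
    move=> i j ij; rewrite FE; case: (eqVneq j z) => [jz|]; last by rewrite mulr0.
    by rewrite sv' ?mul0r // -jz.
  apply: generically_true => t; split; first exact: lower_unipotent_line.
  have <- : t *: shift_differential z u v' = shift_coords z (u + t *: F).
    apply/shift_coordsP; first exact/lower_unipotent_unit/lower_unipotent_line.
    have -> : col z (u + t *: F) = col z u + t *: col z v'.
      by apply/colP => i; rewrite !mxE big_ord1 !mxE !eqxx mulr1.
    rewrite mulmxDr cz add0r -!scalemxAr mulmxDl dE mulKVmx // -dE.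
    have -> : t *: F *m shift_differential z u v' = 0; last by rewrite addr0.
    rewrite -scalemxAl -mulmxA -rowE (_ : row z _ = 0) ?mulmx0 ?scaler0 //.
    by apply/rowP => j; rewrite mxE [RHS]mxE ord1 dv'z.
  by move=> i mi; rewrite mxE dv' mxE [X in _ + X]mxE [X in - X]mxE dv // dw // mulr0 subrr mulr0.
have tD : tangent_at u D.
  apply: (tangent_curve _ (mx_velocity_line u D)); first by rewrite scale0r addr0.
  have Dz i : D i z = 0 by rewrite mxE [X in _ + X]mxE FE eqxx mulr1 subrr.
  have sD : strictly_lower D.
    move=> i j ij; rewrite mxE [X in _ + X]mxE FE sv' //.
    case: (eqVneq j z) => [jz|]; last by rewrite mulr0 subrr.
    by rewrite sv' ?mul0r ?subrr // -jz.
  apply: generically_true => t; split; first exact: lower_unipotent_line.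
  move=> i _; rewrite /shift_coords (_ : col z _ = col z u) ?cz ?mulmx0 ?mxE //.
  by apply/colP => k; rewrite mxE [LHS]mxE [X in _ + X]mxE Dz mulr0 addr0 mxE.
have -> : mxvec v = mxvec F + mxvec D + c *: mxvec w.
  by rewrite -linearZ -!linearD /= /D [F + _]addrC subrK /v' subrK.
by apply: tangent_vectorD; [apply: tangent_vectorD | apply: tangent_vectorZ].
Qed.

Lemma on_hess_coord_lt u (k : 'I_n) : on_hess m z u -> shift_coords z u k 0 != 0 -> (k < m)%N.
Proof. by move=> [_ a0]; rewrite ltnNge; apply: contra => /a0 ->. Qed.

(** Either c_1 = e_1, or some retraction is defined at u. *)
Lemma on_hess_dichotomy u : on_hess m z u ->
  (forall i, i != z -> u i z = 0) \/
  exists k, [/\ k != z, (k < m)%N & shift_coords z u k 0 != 0].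
Proof.
move=> hu; case: (pickP [pred k | (k != z) && (shift_coords z u k 0 != 0)]) => [k|h].
  by move=> /= /andP[kz ak]; right; exists k; split=> //; apply: on_hess_coord_lt ak.
left; apply: shift_coords_eq0_col => //; first by case: hu.
by move=> i iz; have := h i; rewrite /= iz => /negbFE/eqP.
Qed.

(** The equations cut out the tangent space of the reduced Hessenberg set, even at
    points where their differentials are dependent. *)
Lemma tangent_hess u v : on_hess m z u -> tangent_at u v <->
  strictly_lower v /\ forall i : 'I_n, (m <= i)%N -> shift_differential z u v i 0 = 0.
Proof.
move=> hu; split=> [|[sv dv]]; first exact: tangent_hess_necessary.
have [uz|[k [kz km ak]]] := on_hess_dichotomy hu; first exact: tangent_hess_axis.
have [w hw /(_ dv) wv] := mx_velocity_retraction infK kz km hu ak sv.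
rewrite -wv; apply: (tangent_curve _ hw).
  by rewrite scale0r addr0 hess_retraction_id.
have uul t : lower_unipotent (u + t *: v) by apply: lower_unipotent_line => //; case: hu.
have := velocity_shift_coords z infK uul (mx_velocity_line u v) k 0.
move/velocity_neq0; rewrite scale0r addr0 => /(_ ak).
by apply: generically_sub => t; apply: on_hess_retraction.
Qed.

(** Points with a_2 = 0 are limits of points with a_2 <> 0: along [axis_curve] when
    c_1 = e_1, and otherwise along the image under a retraction of the line that
    increases the third entry of c_1, which increases a_2 at the same rate. *)
Lemma hess_cell_dense g :
  (forall u, on_hess m z u -> shift_coords z u o1 0 != 0 -> peval g (mxvec u) = 0) ->
  vanishing_ideal (hess_cell m z) g.
Proof.
move=> gI x hx; rewrite -[x]vec_mxK; move: (vec_mx x) (hx : on_hess m z (vec_mx x)).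
move=> {hx}u hu; have uu := hu.1.
pose Z' (y : 'rV[K]_(n * n)) := on_hess m z (vec_mx y) /\ shift_coords z (vec_mx y) o1 0 != 0.
have gI' : vanishing_ideal Z' g by move=> y [hy ay]; rewrite -[y]vec_mxK; apply: gI.
have close (gam : K -> 'M[K]_n) w : gam 0 = u -> mx_velocity gam w ->
    generically (fun t => on_hess m z (gam t) /\ shift_coords z (gam t) o1 0 != 0) ->
    peval g (mxvec u) = 0.
  move=> <- gw gZ.
  have [|] := @generic_curve_limit _ infK _ Z' _ _ g (curve_velocity_mxvec gw) _ gI'.
    by apply: generically_sub gZ => t; rewrite /Z' mxvecK.
  by [].
have [uz|[k [kz km ak]]] := on_hess_dichotomy hu.
  have [w [b [hw _]]] := axis_curve_velocity uu uz.
  apply: (close _ _ (axis_curve0 uu uz) hw).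
  apply: generically_sub (generically_neq0 _) => t t0.
  by have [h ->] := axis_curve_on_hess t uu; split=> //; apply: axis_beta_neq0.
have [a1|a1] := eqVneq (shift_coords z u o1 0) 0; last exact: gI.
pose v : 'M[K]_n := delta_mx o2 z.
have sv : strictly_lower v.
  move=> i j ij; rewrite mxE; case: eqP => //= i2; case: eqP => // jz.
  by move: ij; rewrite i2 jz o22 z0.
have [w hw _] := mx_velocity_retraction infK kz km hu ak sv.
apply: (close _ _ _ hw); first by rewrite scale0r addr0 hess_retraction_id.
have uul t : lower_unipotent (u + t *: v) by apply: lower_unipotent_line.
have := velocity_shift_coords z infK uul (mx_velocity_line u v) k 0.
move/velocity_neq0; rewrite scale0r addr0 => /(_ ak) gk.
apply: generically_sub (generically_and gk (generically_neq0 _)) => t [akt t0].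
split; first exact: on_hess_retraction.
rewrite hess_retraction_coords // mxE [X in _ + X]mxE [X in - X]mxE leqNgt o11.
rewrite (proj1 (andP hm)) /= subr0 (shift_coords_1 z0 (uul t) o11 o22).
have -> : (u + t *: v) o2 z = u o2 z + t by rewrite !mxE !eqxx mulr1.
have -> : (u + t *: v) o1 z = u o1 z.
  by rewrite !mxE -val_eqE /= o11 o22 /= mulr0 addr0.
by rewrite addrAC -(shift_coords_1 z0 uu o11 o22) a1 add0r.
Qed.
End HessenbergTangent.

(** * Irreducibility, dimension and the singular points *)

Section HessenbergDimension.
Variables (K : fieldType) (infK : infinite_field K) (n m : nat) (z o1 o2 l : 'I_n).
Hypotheses (z0 : z = 0%N :> nat) (o11 : o1 = 1%N :> nat) (o22 : o2 = 2%N :> nat).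
Hypotheses (ln : l.+1 = n) (hm : (1 < m < n)%N).
Notation N := (nilpotent_block K n).
Implicit Types (u v : 'M[K]_n).

Definition position (k : 'I_(n * n)) : 'I_n * 'I_n :=
  enum_val (cast_ord (esym (mxvec_cast n n)) k).

Lemma mxvec_indexK i j : position (mxvec_index i j) = (i, j).
Proof. by rewrite /position /mxvec_index cast_ordK enum_rankK. Qed.

Lemma positionK k : mxvec_index (position k).1 (position k).2 = k.
Proof. by case/mxvec_indexP: k => i j; rewrite mxvec_indexK. Qed.

Definition lower_positions : {pred 'I_(n * n)} :=
  [pred k | ((position k).2 < (position k).1)%N].

(** The entries of column 2 that the equations determine from the other ones when
    a_2 <> 0. *)
Definition solved_position (i j : 'I_n) : bool := (j == o1) && (m <= i)%N.

Definition free_positions : {pred 'I_(n * n)} :=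
  [pred k | (k \in lower_positions) && ~~ solved_position (position k).1 (position k).2].

Lemma mem_lower_positions i j : (mxvec_index i j \in lower_positions) = (j < i)%N.
Proof. by rewrite inE mxvec_indexK. Qed.

Lemma mem_free_positions i j :
  (mxvec_index i j \in free_positions) = (j < i)%N && ~~ solved_position i j.
Proof. by rewrite inE mem_lower_positions mxvec_indexK. Qed.

Lemma card_ord_ge : #|[pred i : 'I_n | (m <= i)%N]| = (n - m)%N.
Proof.
rewrite -sum1_card (eq_bigl (fun i : 'I_n => (m <= i)%N)) //.
by rewrite -(big_geq_mkord m n xpredT (fun=> 1%N)) sum_nat_const_nat muln1.
Qed.

(** If p = q + y e_2^T with y supported in rows of index at least m, then
    q (a(q) - a(p)) = a_2(p) y, where the coordinates a(q) - a(p) are supported in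
    indices below m; forward substitution makes both sides vanish. *)
Lemma on_hess_determined (p q : 'M[K]_n) : on_hess m z p -> on_hess m z q ->
  (forall i j, ~~ solved_position i j -> p i j = q i j) ->
  shift_coords z p o1 0 != 0 -> p = q.
Proof.
move=> hp hq pq ap; have [up uq] := (hp.1, hq.1).
set a := shift_coords z p in ap *; set b := shift_coords z q.
have pE : p = q + col o1 (p - q) *m delta_mx 0 o1.
  apply/matrixP => i j; rewrite mxE [X in _ + X]mxE big_ord1 [delta_mx _ _ _ _]mxE eqxx.
  rewrite !mxE; case: (eqVneq j o1) => [->|jo]; first by rewrite mulr1 addrC subrK.
  by rewrite mulr0 addr0 pq // /solved_position (negbTE jo).
have zo : z != o1 by rewrite -val_eqE /= z0 o11.
have cz : col z p = col z q.
  by apply/colP => i; rewrite !mxE pq // /solved_position (negbTE zo).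
have E : q *m (b - a) = a o1 0 *: col o1 (p - q).
  rewrite mulmxBr (mul_shift_coords z (lower_unipotent_unit uq)) -cz.
  rewrite -(mul_shift_coords z (lower_unipotent_unit up)) -/a -mulmxBl.
  rewrite {1}pE addrC addKr -mulmxA -rowE (_ : row o1 a = (a o1 0)%:M) ?mul_mx_scalar //.
  by apply/matrixP => i j; rewrite !ord1 mxE [RHS]mxE eqxx.
have ba : b - a = 0.
  apply/colP => i; rewrite [RHS]mxE; case: (leqP m i) => im.
    by rewrite mxE [X in _ + X]mxE hp.2 ?hq.2 ?subrr.
  apply: (unipotent_mul_inj0 (m := m) uq) im => i' im'.
  rewrite E; move: (a o1 0) => c; rewrite !mxE pq ?subrr ?mulr0 //.
  by rewrite /solved_position negb_and -ltnNge im' orbT.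
have c0 : col o1 (p - q) = 0.
  move/eqP: E; rewrite ba mulmx0 eq_sym scaler_eq0 (negbTE ap) => /eqP //.
by rewrite pE c0 mul0mx addr0.
Qed.

Notation E := #|free_positions|.

Definition param_mx : 'M[{mpoly K[E]}]_n :=
  \matrix_(i, j) ((i == j)%:R%:MP +
     \sum_(e < E) (enum_val e == mxvec_index i j)%:R *: 'X_e).

Definition param_eval (v : 'I_E -> K) : 'M[K]_n := map_mx (meval v) param_mx.

Lemma param_evalE (v : 'I_E -> K) i j : param_eval v i j =
  (i == j)%:R + \sum_(e < E) (enum_val e == mxvec_index i j)%:R * v e.
Proof.
rewrite !mxE mevalD mevalC; congr (_ + _); rewrite raddf_sum.
by apply: eq_bigr => e _; rewrite /= mevalZ mevalXU.
Qed.

Lemma param_eval_fixed (v : 'I_E -> K) i j : mxvec_index i j \notin free_positions ->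
  param_eval v i j = (i == j)%:R.
Proof.
move=> nf; rewrite param_evalE big1 ?addr0 // => e _.
case: eqP => [ee|]; last by rewrite mul0r.
by rewrite -ee enum_valP in nf.
Qed.

Lemma param_eval_free (v : 'I_E -> K) e : param_eval v (position (enum_val e)).1 (position (enum_val e)).2 = v e.
Proof.
rewrite param_evalE positionK (bigD1 e) //= eqxx mul1r big1 ?addr0 => [|e' e'e].
  have := enum_valP e; rewrite -{1}[enum_val e]positionK mem_free_positions => /andP[lt _].
  by rewrite (_ : (_ == _) = false) ?add0r // -val_eqE gtn_eqF.
by rewrite (inj_eq enum_val_inj) (negbTE e'e) mul0r.
Qed.

Lemma param_eval_unipotent (v : 'I_E -> K) : lower_unipotent (param_eval v).
Proof.
split=> [i j ij|i]; rewrite param_eval_fixed ?eqxx //.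
- by rewrite (_ : (i == j) = false) // -val_eqE /=; lia.
- by rewrite mem_free_positions ltnNge ltnW.
- by rewrite mem_free_positions ltnn.
Qed.

Definition param_delta : {mpoly K[E]} := poly_shift_coords z param_mx o1 0.

(** The entries of the retraction of [param_mx], cleared of their common
    denominator a_2. *)
Definition param_num (k : 'I_(n * n)) : {mpoly K[E]} :=
  mxvec (param_delta *: param_mx + param_mx *m tail_col m (poly_shift_coords z param_mx)
     *m delta_mx 0 o1) 0 k.

Lemma param_deltaE (v : 'I_E -> K) : param_delta.@[v] = shift_coords z (param_eval v) o1 0.
Proof. by rewrite /param_delta poly_shift_coordsE //; apply: param_eval_unipotent. Qed.

Lemma param_pointE (v : 'I_E -> K) : param_delta.@[v] != 0 ->
  param_point param_num param_delta v = mxvec (hess_retraction m z o1 (param_eval v)).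
Proof.
move=> dv; apply/rowP => k; case/mxvec_indexP: k => i j.
rewrite mxvecE hess_retractionE mxE /param_num mxvecE -param_deltaE.
set A := poly_shift_coords z param_mx.
have tE : map_mx (meval v) (tail_col m A) = tail_col m (shift_coords z (param_eval v)).
  apply/colP => k; rewrite mxE [X in X.@[v]]mxE [RHS]mxE; case: ifP => _; last exact: meval0.
  by rewrite /A poly_shift_coordsE //; apply: param_eval_unipotent.
rewrite -tE -map_mxM /=; move: (param_mx *m tail_col m A) => B.
rewrite mxE [X in X + _]mxE [X in _ + X]mxE big_ord1 [delta_mx _ _ _ _]mxE eqxx.
rewrite mevalD !mevalM [map_mx _ B _ _]mxE [param_eval v i j]mxE.
rewrite (_ : ((j == o1)%:R : {mpoly K[E]}).@[v] = (j == o1)%:R); last first.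
  by case: (j == o1); rewrite ?meval1 ?meval0.
by rewrite mulrDl mulrAC mulfV // mul1r [_^-1 * _]mulrC.
Qed.

Lemma param_delta_neq0 : param_delta != 0.
Proof.
pose v (e : 'I_E) : K := (enum_val e == mxvec_index o2 z)%:R.
have zo : (z == o1) = false by rewrite -val_eqE /= z0 o11.
suff : param_delta.@[v] != 0 by apply: contraNneq => ->; rewrite meval0.
rewrite param_deltaE (shift_coords_1 z0 (param_eval_unipotent v) o11 o22).
have f2 : mxvec_index o2 z \in free_positions.
  by rewrite mem_free_positions /solved_position zo z0 o22.
have -> : param_eval v o2 z = 1.
  have := param_eval_free v (enum_rank_in f2 (mxvec_index o2 z)).
  by rewrite /v enum_rankK_in // mxvec_indexK eqxx.
have -> : param_eval v o1 z = 0.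
  rewrite param_evalE eq_sym zo add0r big1 // => e _; rewrite /v.
  case: eqP => [->|]; last by rewrite mul0r.
  rewrite mul1r; case: eqP => // /(congr1 position); rewrite !mxvec_indexK => -[/(congr1 val)] /=.
  by rewrite o11 o22.
by rewrite expr0n subr0 oner_neq0.
Qed.

Let oz : o1 != z. Proof. by rewrite -val_eqE /= z0 o11. Qed.
Let o1m : (o1 < m)%N. Proof. by rewrite o11; case/andP: hm. Qed.

Lemma hess_retraction_free u i j : lower_unipotent u -> ~~ solved_position i j ->
  hess_retraction m z o1 u i j = u i j.
Proof.
move=> uu ns; rewrite hess_retractionE; case: (eqVneq j o1) ns => [->|_ _]; last first.
  by rewrite !mulr0 addr0.
rewrite /solved_position eqxx /= -ltnNge => im.
by rewrite tail_mul_eq0 ?mul0r ?mulr0 ?addr0 //; case: uu.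
Qed.

Lemma param_in_hess (v : 'I_E -> K) : param_delta.@[v] != 0 ->
  hess_cell m z (param_point param_num param_delta v).
Proof.
move=> dv; rewrite param_pointE // /hess_cell mxvecK.
apply: on_hess_retraction => //; first exact: param_eval_unipotent.
by rewrite -param_deltaE.
Qed.

Lemma param_dense_hess g : (forall v : 'I_E -> K, param_delta.@[v] != 0 ->
    peval g (param_point param_num param_delta v) = 0) ->
  vanishing_ideal (hess_cell m z) g.
Proof.
move=> gv; apply: (hess_cell_dense infK z0 o11 o22 ln hm) => u hu au.
pose v (e : 'I_E) := mxvec u 0 (enum_val e).
have agree i j : ~~ solved_position i j -> param_eval v i j = u i j.
  move=> ns; have [ij|ij|ij] := ltngtP i j.
  - rewrite (param_eval_unipotent v).1 // hu.1.1 //.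
  - have f : mxvec_index i j \in free_positions by rewrite mem_free_positions ij.
    have := param_eval_free v (enum_rank_in f (mxvec_index i j)).
    by rewrite /v enum_rankK_in // mxvec_indexK mxvecE.
  - by rewrite (val_inj ij) (param_eval_unipotent v).2 hu.1.2.
have zs i : ~~ solved_position i z by rewrite /solved_position eq_sym (negbTE oz).
have aE : shift_coords z (param_eval v) o1 0 = shift_coords z u o1 0.
  rewrite (shift_coords_1 z0 (param_eval_unipotent v) o11 o22).
  by rewrite (shift_coords_1 z0 hu.1 o11 o22) !agree.
have dv : param_delta.@[v] != 0 by rewrite param_deltaE aE.
rewrite -(gv v dv) param_pointE //; congr (peval g (mxvec _)).
apply: on_hess_determined => //.
  by apply: on_hess_retraction; rewrite ?aE //; apply: param_eval_unipotent.
by move=> i j ns; rewrite hess_retraction_free ?agree //; apply: param_eval_unipotent.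
Qed.

Definition free_index (e : 'I_E) : 'I_(n * n) := enum_val e.

Lemma param_coord_hess (v : 'I_E -> K) : param_delta.@[v] != 0 ->
  forall e, param_point param_num param_delta v 0 (free_index e) = v e.
Proof.
move=> dv e; rewrite param_pointE // -[free_index e]positionK mxvecE.
rewrite hess_retraction_free ?param_eval_free //; first exact: param_eval_unipotent.
have := enum_valP e; rewrite -{1}[enum_val e]positionK mem_free_positions => /andP[_].
by [].
Qed.

Lemma hess_cell_irreducible : irreducible_closed (@hess_cell K n m z).
Proof.
apply: (param_irreducible infK param_delta_neq0 param_in_hess param_dense_hess).
exact: hess_cell_closed.
Qed.

Lemma hess_cell_has_dim : has_dim (@hess_cell K n m z) E.
Proof.
exact: (param_has_dim infK param_delta_neq0 param_in_hess param_coord_hess param_dense_hess).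
Qed.

Lemma card_lower_positions : #|lower_positions| = (E + (n - m))%N.
Proof.
rewrite -(cardID free_positions lower_positions); congr (_ + _)%N.
  by apply: eq_card => k; rewrite !inE; case: (_ < _)%N.
rewrite -card_ord_ge -(card_image (f := fun i : 'I_n => mxvec_index i o1)); last first.
  by move=> i j /(congr1 position); rewrite !mxvec_indexK => -[].
apply: eq_card => k; apply/idP/imageP => [|h].
  rewrite -[k]positionK; case: (position k) => i j /=.
  rewrite !inE !mxvec_indexK /= andbC negb_and negbK.
  by case/andP => -> /= /andP[/eqP -> mi]; exists i.
case: h => i; rewrite inE => mi ->; rewrite !inE !mxvec_indexK /= /solved_position eqxx mi /= andbF /=.
by rewrite (leq_trans o1m).
Qed.

Definition tangent_fun u (x : 'rV[K]_(n * n)) : 'rV[K]_n :=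
  (tail_col m (shift_differential z u (vec_mx x)))^T.

Lemma tangent_fun_linear u : linear (tangent_fun u).
Proof.
move=> c x y; rewrite /tangent_fun /shift_differential.
have -> : col z (vec_mx (c *: x + y)) = c *: col z (vec_mx x) + col z (vec_mx y).
  by rewrite !linearP.
rewrite [vec_mx (_ + _)]linearP mulmxDl [N *m _]mulmxDr -scalemxAl.
rewrite -[N *m (c *: _)]scalemxAr opprD addrACA -scalerBr mulmxDr -scalemxAr.
move: (invmx u *m (N *m col z (vec_mx x) - _)) (invmx u *m _) => A B.
by apply/rowP => i; rewrite !mxE; case: ifP; rewrite ?mulr0 ?addr0.
Qed.

HB.instance Definition _ u := GRing.isLinear.Build K 'rV[K]_(n * n) 'rV[K]_n *:%R
  (tangent_fun u) (tangent_fun_linear u).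

Definition tangent_space u : {vspace 'rV[K]_(n * n)} :=
  (coord_space K lower_positions :&: lker (linfun (tangent_fun u)))%VS.

Lemma mem_lower_space v : strictly_lower v <-> mxvec v \in coord_space K lower_positions.
Proof.
split=> [sv|/coord_spaceP h i j ij].
  apply/coord_spaceP => k; rewrite -[k]positionK mem_lower_positions -leqNgt => ij.
  by rewrite mxvecE sv.
by rewrite -mxvecE h // mem_lower_positions -leqNgt.
Qed.

Lemma tail_colP (a : 'cV[K]_n) :
  (forall i : 'I_n, (m <= i)%N -> a i 0 = 0) <-> tail_col m a = 0.
Proof.
split=> [a0|h i mi]; first by apply/colP => i; rewrite mxE [RHS]mxE; case: ifP => // /a0.
by have /colP/(_ i) := h; rewrite mxE [RHS]mxE mi.
Qed.

Lemma tangent_spaceP u : on_hess m z u ->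
  is_tangent_space (@hess_cell K n m z) (mxvec u) (tangent_space u).
Proof.
move=> hu x; rewrite -[x]vec_mxK; move: (vec_mx x) => v.
have -> : (forall f, vanishing_ideal (hess_cell m z) f ->
    \sum_(i < n * n) peval f^`M(i) (mxvec u) * mxvec v 0 i = 0) <->
    strictly_lower v /\ forall i : 'I_n, (m <= i)%N -> shift_differential z u v i 0 = 0.
  exact: (tangent_hess infK z0 o11 o22 ln hm).
rewrite memv_cap memv_ker lfunE /= /tangent_fun mxvecK tail_colP; split.
  case/andP => /mem_lower_space sv /eqP/(congr1 trmx); rewrite trmxK trmx0.
  by split.
by case=> /mem_lower_space -> ->; rewrite trmx0 eqxx.
Qed.

Definition tail_space : {vspace 'rV[K]_n} := coord_space K [pred i : 'I_n | (m <= i)%N].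

Lemma mem_tail_space (y : 'rV[K]_n) : y \in tail_space -> tail_col m y^T = y^T.
Proof.
move/coord_spaceP => y0; apply/colP => i; rewrite mxE; case: ifP => // mi.
by rewrite mxE y0 // inE mi.
Qed.

(** By rank and nullity on the space of strictly lower triangular matrices, whose
    dimension exceeds the number of free positions by n - m. *)
Lemma dim_tangent_space u :
  \dim (tangent_space u) = E <->
  (forall y, y \in tail_space -> exists2 v, strictly_lower v & tangent_fun u (mxvec v) = y).
Proof.
set L := linfun (tangent_fun u); set SL := coord_space K lower_positions.
have dimE : (\dim (tangent_space u) + \dim (L @: SL) = E + (n - m))%N.
  by rewrite /tangent_space limg_ker_dim dim_coord_space card_lower_positions.
have sub : (L @: SL <= tail_space)%VS.
  apply/subvP => y /memv_imgP[x _ ->]; rewrite lfunE /=; apply/coord_spaceP => i.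
  by rewrite inE => /negbTE mi; rewrite !mxE mi.
have dW : \dim tail_space = (n - m)%N by rewrite dim_coord_space card_ord_ge.
have -> : (\dim (tangent_space u) = E) <-> (tail_space <= L @: SL)%VS.
  split=> [dT|le].
    have : (L @: SL == tail_space)%VS by rewrite eqEdim sub dW; lia.
    by move/eqP => ->.
  have := anti_leq (introT andP (conj (dimvS sub) (dimvS le))).
  rewrite dW; lia.
split=> [/subvP h y /h/memv_imgP[x xS ->]|h].
  exists (vec_mx x); first by apply/mem_lower_space; rewrite vec_mxK.
  by rewrite lfunE /= vec_mxK.
apply/subvP => y /h[v /mem_lower_space sv <-]; apply/memv_imgP.
by exists (mxvec v) => //; rewrite lfunE.
Qed.

(** Column k alone is varied, which changes a by - a_k u^-1 v_k. *)
Lemma tangent_onto_regular u k : on_hess m z u -> k != z -> (k < m)%N ->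
  shift_coords z u k 0 != 0 -> forall y, y \in tail_space ->
  exists2 v, strictly_lower v & tangent_fun u (mxvec v) = y.
Proof.
move=> hu kz km ak y yW; have uu := hu.1; have uU := lower_unipotent_unit uu.
set a := shift_coords z u in ak.
pose w := - (a k 0)^-1 *: (u *m y^T).
exists (w *m delta_mx 0 k).
  move=> i j ij; rewrite mxE big_ord1 [delta_mx _ _ _ _]mxE eqxx /=.
  case: (eqVneq j k) => [jk|_]; last by rewrite mulr0.
  rewrite mxE -(mem_tail_space yW) tail_mul_eq0 ?mulr0 ?mul0r //; first by case: uu.
  by apply: leq_ltn_trans ij _; rewrite jk.
rewrite /tangent_fun mxvecK /shift_differential -/a.
have -> : col z (w *m delta_mx 0 k) = 0.
  apply/colP => i; rewrite mxE [LHS]mxE big_ord1 [delta_mx _ _ _ _]mxE [RHS]mxE.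
  by rewrite [z == k]eq_sym (negbTE kz) andbF mulr0.
have ek : (delta_mx 0 k : 'rV[K]_n) *m a = (a k 0)%:M.
  by rewrite -rowE; apply/matrixP => i j; rewrite !ord1 mxE [RHS]mxE eqxx mulr1n.
rewrite mulmx0 sub0r -mulmxA ek mul_mx_scalar scalerA mulrN mulfV // scaleN1r opprK.
by rewrite mulKmx // (mem_tail_space yW) trmxK.
Qed.

Lemma shift_up_mul (w : 'cV[K]_n) : w l 0 = 0 -> N *m (N^T *m w) = w.
Proof.
move=> wl; apply/colP => i; case: (eqVneq i l) => [->|il].
  by rewrite nilpotent_mul_last.
have lt : (i.+1 < n)%N by move: il (ltn_ord i); rewrite -val_eqE /=; lia.
rewrite (@nilpotent_mul _ _ _ _ _ (Ordinal lt)) // mxE (bigD1 i) //= !mxE eqxx mul1r.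
rewrite big1 ?addr0 // => j ji; rewrite !mxE /= eqSS eq_sym (inj_eq val_inj).
by rewrite (negbTE ji) mul0r.
Qed.

Lemma shift_up_z (w : 'cV[K]_n) : (N^T *m w) z 0 = 0.
Proof. by rewrite mxE big1 // => j _; rewrite !mxE z0 mul0r. Qed.

Section OnAxis.
Variable u : 'M[K]_n.
Hypotheses (hu : on_hess m z u) (uz : forall i, i != z -> u i z = 0).

Lemma axis_shift_coords : shift_coords z u = 0.
Proof.
rewrite /shift_coords (_ : N *m _ = 0) ?mulmx0 //; apply/colP => i; rewrite [RHS]mxE.
case: (eqVneq i l) => [->|il]; first by rewrite nilpotent_mul_last.
have lt : (i.+1 < n)%N by move: il (ltn_ord i); rewrite -val_eqE /=; lia.
by rewrite (@nilpotent_mul _ _ _ _ _ (Ordinal lt)) // mxE uz // -val_eqE /= z0.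
Qed.

Lemma axis_shift_differential v : shift_differential z u v = invmx u *m (N *m col z v).
Proof. by rewrite /shift_differential axis_shift_coords mulmx0 subr0. Qed.

(** The preimage must satisfy N v_1 = w with w_n = 0: the vector u y is corrected by
    the multiple of c_j that cancels its last entry, which does not change the
    coordinates of index at least m. *)
Lemma tangent_onto_axis (j : 'I_n) : (j < m)%N -> u l j != 0 ->
  forall y, y \in tail_space ->
  exists2 v, strictly_lower v & tangent_fun u (mxvec v) = y.
Proof.
move=> jm ulj y yW; have uU := lower_unipotent_unit hu.1.
pose c := (u *m y^T) l 0 / u l j; pose w := u *m y^T - c *: col j u.
have wl : w l 0 = 0.
  rewrite mxE [X in _ + X]mxE [X in - X]mxE [col j u _ _]mxE /c divfK ?subrr //.
exists ((N^T *m w) *m delta_mx 0 z).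
  move=> i k ik; rewrite mxE big_ord1 [delta_mx _ _ _ _]mxE eqxx /=.
  case: (eqVneq k z) => [kz|_]; last by rewrite mulr0.
  have -> : i = z by apply: val_inj; move: ik; rewrite kz /= z0; lia.
  by rewrite shift_up_z mul0r.
rewrite /tangent_fun mxvecK axis_shift_differential.
have -> : col z (N^T *m w *m delta_mx 0 z) = N^T *m w.
  apply/colP => i; rewrite mxE [LHS]mxE big_ord1 [delta_mx _ _ _ _]mxE.
  by rewrite !eqxx mulr1.
rewrite shift_up_mul // /w mulmxBr mulKmx // -scalemxAr colE mulKmx //.
rewrite -[RHS]trmxK; congr (_^T); rewrite -[RHS](mem_tail_space yW).
apply/colP => i; rewrite mxE [RHS]mxE; case: ifP => // mi.
rewrite mxE [X in _ + X]mxE [X in - X]mxE [delta_mx _ _ _ _]mxE.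
rewrite (_ : (i == j) = false) ?mulr0 ?subr0 //.
by rewrite -val_eqE gtn_eqF //; apply: leq_trans mi.
Qed.

(** The last entry of N v_1 = u c is 0, and it only involves the coordinates of c of
    index at least m: these satisfy a fixed linear relation. *)
Lemma tangent_not_onto : (forall j : 'I_n, (j < m)%N -> u l j = 0) ->
  ~ (forall y, y \in tail_space -> exists2 v, strictly_lower v & tangent_fun u (mxvec v) = y).
Proof.
move=> ul onto; have uU := lower_unipotent_unit hu.1.
have [|v _] := onto (delta_mx 0 l).
  apply/coord_spaceP => i; rewrite inE => mi; rewrite mxE eqxx.
  by case: eqP => //= il; rewrite il in mi; move: mi; lia.
rewrite /tangent_fun mxvecK axis_shift_differential.
set c := invmx u *m _ => cE.
have := nilpotent_mul_last (col z v) 0 ln; rewrite -(mulKVmx uU (N *m _)) -/c mxE.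
rewrite (bigD1 l) //= hu.1.2 mul1r big1 => [|j jl].
  have /rowP/(_ l) := cE; rewrite mxE [LHS]mxE [RHS]mxE !eqxx ifT; last by lia.
  by move=> ->; rewrite addr0 => /eqP; rewrite oner_eq0.
case: (leqP m j) => mj; last by rewrite ul ?mul0r.
have /rowP/(_ j) := cE; rewrite mxE [LHS]mxE [RHS]mxE mj (negbTE jl) andbF => ->.
by rewrite mulr0.
Qed.
End OnAxis.

(** In terms of flags, the conditions say that V_1 = F_1 and that V_m is contained in
    F_(n-1): this is where the differentials of the equations become dependent. *)
Lemma singular_hess_cell u : lower_unipotent u ->
  singular_point (@hess_cell K n m z) (mxvec u) <->
  (forall i, i != z -> u i z = 0) /\ (forall j : 'I_n, (j < m)%N -> u l j = 0).
Proof.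
move=> uu.
have key : on_hess m z u -> nonsingular_point (@hess_cell K n m z) (mxvec u) <->
    (forall y, y \in tail_space -> exists2 v, strictly_lower v & tangent_fun u (mxvec v) = y).
  move=> hu; rewrite -dim_tangent_space.
  apply: (nonsingular_irreducible hess_cell_irreducible hess_cell_has_dim).
    by rewrite /hess_cell mxvecK.
  exact: tangent_spaceP.
split=> [[]|[uz ul]].
  rewrite {1}/hess_cell mxvecK => hu; rewrite key // => sing.
  have [uz|[k [kz km ak]]] := on_hess_dichotomy z0 hu; last first.
    by case: sing; apply: tangent_onto_regular ak.
  split=> // j jm; apply/eqP/negPn/negP => ulj; case: sing.
  exact: (tangent_onto_axis hu uz jm ulj).
have hu : on_hess m z u by split=> // i _; rewrite axis_shift_coords // mxE.
split; first by rewrite /hess_cell mxvecK.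
by rewrite key //; apply: tangent_not_onto.
Qed.
End HessenbergDimension.

(** * Flags and column spans *)

Lemma card_ord_interval n a b : (#|[set i : 'I_n | (a <= i < b)%N]| <= b - a)%N.
Proof.
rewrite -[X in (_ <= X)%N](size_iota a) cardE -(size_map val); apply: uniq_leq_size.
  by rewrite (map_inj_uniq val_inj) enum_uniq.
move=> x /mapP[k]; rewrite mem_enum inE => /andP[ak kb] -> /=.
by rewrite mem_iota ak subnKC //; apply: leq_trans (ltnW kb).
Qed.

Lemma card_ord_lt n q : #|[pred i : 'I_n | (i < q)%N]| = minn q n.
Proof.
have lt := card_ord_interval n 0 q; have ge := card_ord_interval n q n.
have tot := cardC [pred i : 'I_n | (i < q)%N]; rewrite card_ord in tot.
set c := #|_| in tot *; set c' := #|_| in tot.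
have cE : #|[set i : 'I_n | (0 <= i < q)%N]| = c by apply: eq_card => i; rewrite !inE.
have c'E : #|[set i : 'I_n | (q <= i < n)%N]| = c'.
  by apply: eq_card => i; rewrite !inE -leqNgt ltn_ord andbT.
rewrite cE subn0 in lt; rewrite c'E in ge.
by move: (c) (c') tot lt ge => x y; lia.
Qed.

Section ColumnSpans.
Variables (K : fieldType) (n : nat).
Implicit Types (u : 'M[K]_n) (x : 'cV[K]_n).

Lemma std_space_trmx q : std_space K n q =
  (linfun (@trmx K 1 n) @: coord_space K [pred i : 'I_n | (i < q)%N])%VS.
Proof.
rewrite limg_span -map_comp; congr (span _); rewrite enumT /enum_mem.
by apply: eq_map => i /=; rewrite lfunE /= trmx_delta.
Qed.

Lemma std_spaceP q x :
  reflect (forall i : 'I_n, (q <= i)%N -> x i 0 = 0) (x \in std_space K n q).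
Proof.
have -> : (x \in std_space K n q) = (x^T \in coord_space K [pred i : 'I_n | (i < q)%N]).
  rewrite std_space_trmx.
  apply/memv_imgP/idP => [[y yP ->]|xP]; first by rewrite lfunE /= trmxK.
  by exists x^T => //; rewrite lfunE /= trmxK.
apply: (iffP (coord_spaceP _ _)) => h i; last by rewrite inE -leqNgt mxE => /h.
by move=> qi; have := h i; rewrite inE -leqNgt mxE => ->.
Qed.

Lemma dim_std_space q : \dim (std_space K n q) = minn q n.
Proof.
rewrite -card_ord_lt -(dim_coord_space K) std_space_trmx limg_dim_eq //.
apply/eqP; rewrite -subv0; apply/subvP => y; rewrite memv_cap memv_ker lfunE /=.
by case/andP => _ /eqP/(congr1 trmx); rewrite trmxK trmx0 => ->; rewrite mem0v.
Qed.

Lemma col_span_image u j : col_span u j = (linfun (mulmx u) @: std_space K n j)%VS.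
Proof.
rewrite /col_span /std_space limg_span -map_comp; congr (span _).
by apply: eq_map => i /=; rewrite lfunE /= colE.
Qed.

Lemma col_spanP u j x : u \in unitmx ->
  reflect (forall i : 'I_n, (j <= i)%N -> (invmx u *m x) i 0 = 0) (x \in col_span u j).
Proof.
move=> uU; apply: (iffP idP) => [|h].
  by rewrite col_span_image => /memv_imgP[y /std_spaceP yP ->]; rewrite lfunE /= mulKmx.
rewrite col_span_image -(mulKVmx uU x); apply/memv_imgP.
by exists (invmx u *m x); [apply/std_spaceP | rewrite lfunE].
Qed.

Lemma dim_col_span u j : u \in unitmx -> \dim (col_span u j) = minn j n.
Proof.
move=> uU; rewrite -(dim_std_space j) col_span_image limg_dim_eq //.
apply/eqP; rewrite -subv0; apply/subvP => y; rewrite memv_cap memv_ker lfunE /=.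
by case/andP => _ /eqP uy; rewrite -(mulKmx uU y) uy mulmx0 mem0v.
Qed.

Lemma col_span_mono u i j : (i <= j)%N -> (col_span u i <= col_span u j)%VS.
Proof.
move=> ij; rewrite !col_span_image limgS //; apply/subvP => x /std_spaceP h.
by apply/std_spaceP => k jk; apply: h; apply: leq_trans jk.
Qed.

Definition flag_of u (uU : u \in unitmx) : flag K n :=
  Flag (fun j => dim_col_span j uU) (col_span_mono u).

Lemma col_in_col_span u (i : 'I_n) j : (i < j)%N -> col i u \in col_span u j.
Proof.
by move=> ij; apply/memv_span/map_f; rewrite mem_filter ij mem_enum.
Qed.

Lemma col_span_full u : u \in unitmx -> col_span u n = fullv.
Proof.
move=> uU; apply/eqP; rewrite eqEsubv subvf; apply/subvP => x _.
by apply/col_spanP => // i; rewrite leqNgt ltn_ord.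
Qed.

(** Rescaling the columns of b does not change their spans. *)
Lemma opposite_cell_unipotent V :
  opposite_cell V <-> exists u, lower_unipotent u /\ @represents K n u V.
Proof.
split=> [[b [bU lb VE]]|[u [uu VE]]]; last first.
  exists u; split; [exact: lower_unipotent_unit | by case: uu |].
  by move=> j; rewrite VE col_span_image.
have b0 i : b i i != 0.
  have /is_trig_mxP/det_trig dE := lb.
  move: bU; rewrite unitmxE unitfE dE; apply: contraNneq => bi.
  by rewrite (bigD1 i) //= bi mul0r.
pose D := diag_mx (\row_i b i i); pose D' := diag_mx (\row_i (b i i)^-1).
have DD : D *m D' = 1%:M.
  rewrite mulmx_diag; apply/matrixP => i j; rewrite !mxE mulfV //.
have uE i j : (b *m D') i j = b i j / b j j by rewrite mul_mx_diag !mxE.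
have uu : lower_unipotent (b *m D').
  by split=> [i j ij|i]; rewrite uE ?mulfV // lb // mul0r.
exists (b *m D'); split=> // j; rewrite VE -col_span_image.
have uU := lower_unipotent_unit uu.
have bE (x : 'cV[K]_n) : invmx b *m x = D' *m (invmx (b *m D') *m x).
  by rewrite -{1}(mulKVmx uU x) -[b *m D' *m _]mulmxA mulKmx.
apply/vspaceP => x; apply/col_spanP/col_spanP => // h i ji.
  have := h i ji; rewrite bE mul_diag_mx mxE mxE => /eqP.
  by rewrite mulf_eq0 invr_eq0 (negbTE (b0 i)) => /eqP.
by rewrite bE mul_diag_mx mxE h // mulr0.
Qed.
End ColumnSpans.

Section HessenbergFlags.
Variables (K : fieldType) (n m : nat) (z : 'I_n).
Hypotheses (z0 : z = 0%N :> nat) (hm : (1 < m < n)%N).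
Notation N := (nilpotent_block K n).

(** Only the first condition of h_m is restrictive, and V_1 is spanned by c_1. *)
Lemma hess_flagP u V : lower_unipotent u -> @represents K n u V ->
  Hess N (h_m n m) V <-> on_hess m z u.
Proof.
move=> uu VE; have uU := lower_unipotent_unit uu.
have n0 : (0 < n)%N by rewrite (leq_ltn_trans _ (ltn_ord z)).
split=> [h|[_ az] i hi v].
  split=> // i mi; have := h 1%N n0 (col z u); rewrite !VE /h_m /=.
  by rewrite col_in_col_span ?z0 // => /(_ isT)/(col_spanP _ _ uU); apply.
rewrite !VE /h_m; case: eqP => [->|_]; last by rewrite col_span_full // memvf.
move/(col_spanP _ _ uU); set w := invmx u *m v => w0.
have vE : v = w z 0 *: col z u.
  rewrite -(mulKVmx uU v) -/w colE scalemxAr; congr (_ *m _).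
  apply/colP => k; case: (posnP k) => [k0|k0].
    have -> : k = z by apply: val_inj; rewrite /= k0 z0.
    by rewrite [RHS]mxE [delta_mx _ _ _ _]mxE !eqxx mulr1.
  have kz : (k == z) = false by rewrite -val_eqE /= z0 gtn_eqF.
  by rewrite (w0 k) // [RHS]mxE [delta_mx _ _ _ _]mxE kz mulr0.
rewrite vE -scalemxAr rpredZ //; apply/col_spanP => // k mk; exact: az.
Qed.

Lemma cell_coordinates_hess :
  cell_coordinates (fun V => Hess N (h_m n m) V /\ opposite_cell V) = hess_cell m z.
Proof.
apply/funext => x; apply/propext.
split=> [[u [V [uu VE [hV _] ->]]]|hx].
  by rewrite /hess_cell mxvecK; apply/(hess_flagP uu VE).
have uu := hx.1; have uU := lower_unipotent_unit uu.
exists (vec_mx x), (flag_of uU); split=> //; last by rewrite vec_mxK.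
split; first exact/(hess_flagP uu).
by apply/opposite_cell_unipotent; exists (vec_mx x).
Qed.
End HessenbergFlags.

(** * The Schubert variety of w_m *)

Section SchubertVariety.
Variables (K : fieldType) (n m : nat) (z l : 'I_n) (hm : (2 <= m <= n - 1)%N).
Hypotheses (z0 : z = 0%N :> nat) (ln : l.+1 = n).

Let mn : (1 < m < n)%N. Proof. lia. Qed.
Let om : 'I_n := Ordinal (proj2 (andP mn)).

Definition schubert_count p q : nat := #|[set i : 'I_n | (i < p)%N && (w_m hm i < q)%N]|.

Lemma schubert_count_le p q : (schubert_count p q <= p)%N.
Proof.
apply: leq_trans (_ : #|[set i : 'I_n | (0 <= i < p)%N]| <= _)%N.
  by apply/subset_leq_card/subsetP => i; rewrite !inE => /andP[].
by rewrite -[X in (_ <= X)%N](subn0 p) card_ord_interval.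
Qed.

(** The bound is the least possible dimension of the intersection of V_p and F_q
    when both contain e_1 and are contained in F_(n-1); the next lemma is the
    analogue when V_p need not lie in F_(n-1). *)
Lemma schubert_count_low p q : (1 <= p <= m)%N -> (1 <= q <= n - 2)%N ->
  (schubert_count p q <= maxn 1 (p + q + 1 - n))%N.
Proof.
move=> hp hq; apply: (@leq_trans (#|z |: [set i : 'I_n | (n - q <= i < p)%N]|)).
  apply/subset_leq_card/subsetP => i; rewrite !inE -val_eqE /= z0 => /andP[ip wq].
  have := w_mE hm i; rewrite /w_m_val; move: wq; case: ifP => [/eqP|] i1.
    by move=> _ _; apply/orP; left; lia.
  by move=> wq; rewrite ifT; lia.
rewrite cardsU1; have := card_ord_interval n (n - q) p; case: (_ \notin _) => /=; lia.
Qed.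

Lemma schubert_count_high p q : (m < p <= n)%N -> (1 <= q <= n - 1)%N ->
  (schubert_count p q <= maxn 1 (p + q - n))%N.
Proof.
move=> hp hq.
have sub : [set i : 'I_n | (i < p)%N && (w_m hm i < q)%N] \subset
    z |: ([set i : 'I_n | (n - q <= i < p)%N] :\ om) :&: [set i : 'I_n | (i < m)%N || (n - q < i)%N].
  apply/subsetP => i; rewrite !inE -!val_eqE /= z0 => /andP[ip wq].
  have := w_mE hm i; rewrite /w_m_val; move: wq (ltn_ord i).
  by case: ifP => [/eqP|] i1; [|case: ifP => i2; [|case: ifP => [/eqP|] i3]]; lia.
apply: leq_trans (subset_leq_card sub) _; rewrite cardsU1.
set A := _ :&: _; suff : (#|A| <= (p + q - n).-1)%N by case: (_ \notin _) => /=; lia.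
case: (leqP (n - q) m) => qm.
  apply: (@leq_trans #|[set i : 'I_n | (n - q <= i < p)%N] :\ om|).
    by apply/subset_leq_card/subsetIl.
  have := card_ord_interval n (n - q) p.
  rewrite (cardsD1 om) inE /= (_ : (n - q <= m < p)%N); last lia.
  rewrite /=; lia.
apply: (@leq_trans #|[set i : 'I_n | ((n - q).+1 <= i < p)%N]|).
  by apply/subset_leq_card/subsetP => i; rewrite !inE -!val_eqE /=; lia.
by apply: leq_trans (card_ord_interval _ _ _) _; lia.
Qed.

(** The two conditions are those of indices (1, 1) and (m, n - 1).  Conversely they
    imply all the others by the dimension formula for the intersection of V_p and
    F_q, computed inside F_(n-1) if p <= m and inside K^n otherwise. *)
Lemma schubert_w_mP u (V : flag K n) : lower_unipotent u -> represents u V ->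
  schubert_variety (w_m hm) V <->
  (forall i, i != z -> u i z = 0) /\ (forall j : 'I_n, (j < m)%N -> u l j = 0).
Proof.
move=> uu VE; have uU := lower_unipotent_unit uu.
have dV j : \dim (V j) = minn j n by apply: flag_dim.
split=> [sV|[uz ul]].
  split.
    have V1 : (V 1%N <= std_space K n 1)%VS.
      have : (1 <= \dim (V 1%N :&: std_space K n 1))%N.
        apply: leq_trans (sV 1%N 1%N _ _); try lia.
        rewrite card_gt0; apply/set0Pn; exists z; rewrite inE z0 /=.
        by have := w_mE hm z; rewrite z0 /w_m_val /=; lia.
      move=> d1; suff /eqP <- : (V 1%N :&: std_space K n 1 == V 1%N)%VS by apply: capvSr.
      by rewrite eqEdim capvSl dV; lia.
    move=> i iz; have /subvP/(_ (col z u)) := V1.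
    rewrite VE col_in_col_span ?z0 // => /(_ isT)/std_spaceP/(_ i).
    rewrite mxE; apply; rewrite lt0n; apply: contraNneq iz => i0.
    by apply/eqP/val_inj; rewrite /= i0 z0.
  have Vm : (V m <= std_space K n n.-1)%VS.
    have : (m <= \dim (V m :&: std_space K n n.-1))%N.
      apply: leq_trans (sV m n.-1 _ _); try lia.
      rewrite -[X in (X <= _)%N](_ : #|[pred i : 'I_n | (i < m)%N]| = m); last first.
        by rewrite card_ord_lt; lia.
      apply/subset_leq_card/subsetP => i; rewrite !inE => im; rewrite im /=.
      by have := w_mE hm i; rewrite /w_m_val; case: ifP => i1; [|case: ifP => i2]; lia.
    move=> d1; suff /eqP <- : (V m :&: std_space K n n.-1 == V m)%VS by apply: capvSr.
    by rewrite eqEdim capvSl dV; lia.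
  move=> j jm; have /subvP/(_ (col j u)) := Vm.
  rewrite VE col_in_col_span // => /(_ isT)/std_spaceP/(_ l).
  by rewrite mxE; apply; lia.
move=> p q hp hq; rewrite -/(schubert_count p q).
have dF : \dim (std_space K n q) = q by rewrite dim_std_space; lia.
have dVp : \dim (V p) = p by rewrite dV; lia.
have z_in : (1 <= \dim (V p :&: std_space K n q))%N.
  have e1 : col z u \in (V p :&: std_space K n q)%VS.
    rewrite memv_cap VE col_in_col_span ?z0 //=; last lia.
    apply/std_spaceP => i qi; rewrite mxE uz // -val_eqE /= z0; lia.
  rewrite lt0n dimv_eq0; apply: contraTneq e1 => ->; rewrite memv0.
  apply: contra_eqN (uu.2 z) => /eqP/colP/(_ z); rewrite !mxE => ->.
  by rewrite eq_sym oner_neq0.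
have low : (p <= m)%N -> (V p <= std_space K n n.-1)%VS.
  move=> pm; rewrite VE; apply/subvP => x /(col_spanP _ _ uU) x0.
  apply/std_spaceP => i ni; have -> : i = l by apply: val_inj; move: (ltn_ord i) => /=; lia.
  rewrite -(mulKVmx uU x) mxE big1 // => j _; case: (ltnP j p) => jp.
    by rewrite ul ?mul0r //; lia.
  by rewrite x0 ?mulr0.
have Fmono q1 q2 : (q1 <= q2)%N -> (std_space K n q1 <= std_space K n q2)%VS.
  move=> qq; apply/subvP => x /std_spaceP x0; apply/std_spaceP => i qi.
  by apply: x0; apply: leq_trans qi.
have capp : (V p <= std_space K n q)%VS -> (schubert_count p q <= \dim (V p :&: std_space K n q))%N.
  by move/capv_idPl => ->; rewrite dVp schubert_count_le.
have sumcap := dimv_sum_cap (V p) (std_space K n q); rewrite dF dVp in sumcap.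
case: (leqP p m) => pm.
  case: (leqP n.-1 q) => qn; first by apply/capp/(subv_trans (low pm))/Fmono.
  have sub : (V p + std_space K n q <= std_space K n n.-1)%VS.
    by rewrite subv_add low // Fmono //; lia.
  have := dimvS sub; rewrite dim_std_space.
  have := @schubert_count_low p q; lia.
case: (eqVneq q n) => [qn|qn].
  apply: capp; apply/subvP => x _; apply/std_spaceP => i; rewrite qn.
  by rewrite leqNgt ltn_ord.
have := dimvS (subvf (V p + std_space K n q)); rewrite dimvf /dim /= muln1.
have := @schubert_count_high p q; lia.
Qed.
End SchubertVariety.

Theorem corollary1p6 (R : realType) (n m : nat) (hm : (2 <= m <= n - 1)%N)
    (V : flag R[i] n) :
  cell_singular_locus
    (fun V' => Hess (nilpotent_block R[i] n) (h_m n m) V' /\ opposite_cell V') V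
  <-> (schubert_variety (w_m hm) V /\ opposite_cell V).
Proof.
have infK : infinite_field R[i].
  move=> N; exists [seq k%:R | k <- iota 0 N]; rewrite size_map size_iota; split=> //.
  rewrite map_inj_uniq ?iota_uniq // => a b /eqP.
  by rewrite Num.Theory.eqr_nat => /eqP.
have hmn : (1 < m < n)%N by lia.
have lt0 : (0 < n)%N by lia.
have lt1 : (1 < n)%N by lia.
have lt2 : (2 < n)%N by lia.
have ltl : (n.-1 < n)%N by lia.
have ln : (Ordinal ltl).+1 = n by rewrite /=; lia.
have sing u : lower_unipotent u -> _ :=
  @singular_hess_cell _ infK n m (Ordinal lt0) (Ordinal lt1) (Ordinal lt2) (Ordinal ltl)
    erefl erefl erefl ln hmn u.
have schub u : lower_unipotent u -> represents u V -> _ :=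
  @schubert_w_mP _ n m (Ordinal lt0) (Ordinal ltl) hm erefl ln u V.
rewrite /cell_singular_locus (@cell_coordinates_hess R[i] n m (Ordinal lt0) erefl) //.
split=> [[u [uu VE /(sing u uu) su]]|[sV /opposite_cell_unipotent[u [uu VE]]]].
  split; first exact/(schub u uu VE).
  by apply/opposite_cell_unipotent; exists u.
by exists u; split=> //; apply/(sing u uu)/(schub u uu VE).
Qed.
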